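(* Let $(M,g)$ be a Riemannian manifold endowed with a regular Poisson tensor $\pi$ such that the metric contravariant connection $\mathcal D$ associated to $(\pi,g)$ is an $\mathcal F$-connection. Then: (1) the metric $g$ is a bundle-like metric for the symplectic foliation $\mathcal F$ of $\pi$; (2) for any open subset $U$ of $M$ and for any vector field $X$ on $U$ which is perpendicular to the symplectic foliation, $X$ is a foliated vector field if and only if $X$ is a Poisson vector field.
   Context: All objects are smooth. A Poisson tensor on $M$ is a bivector field $\pi\in\Gamma(\wedge^2TM)$ with $[\pi,\pi]=0$ (Schouten-Nijenhuis bracket). Its anchor $\pi_\#:T^*M\to TM$ is defined by $\beta(\pi_\#(\alpha))=\pi(\alpha,\beta)$, and its Koszul bracket on $\Omega^1(M)$ by $[\alpha,\beta]_\pi=L_{\pi_\#(\alpha)}\beta-L_{\pi_\#(\beta)}\alpha-d(\pi(\alpha,\beta))$. $\pi$ is regular if its rank is constant on $M$. The image of $\pi_\#$ is integrable; the resulting foliation $\mathcal F$ is the symplectic foliation. A function $f$ on an open set is a Casimir function if $\pi_\#(df)=0$. Let $\langle\cdot,\cdot\rangle$ be the metric induced by $g$ on covectors. The metric contravariant connection $\mathcal D:\Omega^1(M)\times\Omega^1(M)\to\Omega^1(M)$ associated to $(\pi,g)$ is the unique map, $C^\infty(M)$-linear in the first argument, $\mathbb R$-linear in the second, satisfying $\mathcal D_\alpha(f\beta)=f\mathcal D_\alpha\beta+\pi_\#(\alpha)(f)\beta$, metric compatibility $\pi_\#(\alpha).\langle\beta,\gamma\rangle=\langle\mathcal D_\alpha\beta,\gamma\rangle+\langle\beta,\mathcal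 D_\alpha\gamma\rangle$, and torsion-freeness $\mathcal D_\alpha\beta-\mathcal D_\beta\alpha=[\alpha,\beta]_\pi$. Being tensorial in $\alpha$, $\mathcal D_\alpha$ makes sense for a covector $\alpha\in T^*_pM$. $\mathcal D$ is an $\mathcal F$-connection if for every $p\in M$ and $\alpha\in T_p^*M$, $\pi_\#(\alpha)=0$ implies $\mathcal D_\alpha=0$. A vector field $X$ on an open set $U$ is foliated if $[X,Y]$ is tangent to $\mathcal F$ for every vector field $Y$ on $U$ tangent to $\mathcal F$; it is Poisson if $L_X\pi=0$; it is perpendicular to the foliation if $g(X,Y)=0$ for every vector field $Y$ on $U$ tangent to $\mathcal F$. The metric $g$ is bundle-like for $\mathcal F$ if for every open set $U$ and all foliated vector fields $X,Y$ on $U$ perpendicular to $\mathcal F$, the function $g(X,Y)$ is a Casimir function on $U$. *)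

(* Defs.v *)
From mathcomp Require Import all_boot all_order all_algebra.
From mathcomp Require Import all_classical all_reals all_analysis.

Set Implicit Arguments.
Unset Strict Implicit.
Unset Printing Implicit Defensive.

Import Order.TTheory GRing.Theory Num.Theory.
Import numFieldNormedType.Exports.

Local Open Scope classical_set_scope.
Local Open Scope ring_scope.

(** * Smooth manifolds *)

Section euclidean.
Context {R : realType} {n : nat}.

Definition partial (i : 'I_n) (f : 'rV[R]_n -> R) : 'rV[R]_n -> R :=
  fun x => 'D_(delta_mx 0 i) f x.

(* Meaningful for open A: all iterated partial derivatives (of every order,
   including 0) are continuous on A and can be differentiated once more. *)
Definition smooth_rV (A : set 'rV[R]_n) (f : 'rV[R]_n -> R) : Prop :=
  forall (s : seq 'I_n) x, A x ->
    {for x, continuous (foldr partial f s)} /\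
    forall i : 'I_n, derivable (foldr partial f s) x (delta_mx 0 i).

End euclidean.

(* [fwd] and [bwd] are total functions; only their restrictions to [dom] and to
   [fwd @` dom] matter, where they are inverse homeomorphisms. *)
Record chart (R : realType) (n : nat) (T : topologicalType) := Chart {
  dom : set T;
  fwd : T -> 'rV[R]_n;
  bwd : 'rV[R]_n -> T;
  dom_open : open dom;
  cod_open : open (fwd @` dom);
  fwdK : forall p, dom p -> bwd (fwd p) = p;
  fwd_continuous : forall p, dom p -> {for p, continuous fwd};
  bwd_continuous : forall x, (fwd @` dom) x -> {for x, continuous bwd} }.

(* [chart_at] picks, for each point, one chart of the atlas around it. It is
   not additional geometric structure: it only serves to coordinatize the
   tangent spaces, see below. *)
Record smooth_manifold (R : realType) (n : nat) := SmoothManifold {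
  points :> topologicalType;
  points_hausdorff : hausdorff_space points;
  points_second_countable : @second_countable points;
  atlas : set (chart R n points);
  atlas_compatible : forall c c', atlas c -> atlas c' -> forall i : 'I_n,
    smooth_rV (fwd c @` (dom c `&` dom c')) (fun x => fwd c' (bwd c x) 0 i);
  chart_at : points -> chart R n points;
  chart_at_atlas : forall p, atlas (chart_at p);
  chart_at_dom : forall p, dom (chart_at p) p }.

(** * Tensor calculus

   The tangent space at [p] is identified with ['rV[R]_n] by means of the
   coordinate basis at [p] of the preferred chart [chart_at p], and the
   cotangent space with ['rV[R]_n] by means of the dual basis. A bilinear form
   on either of them is identified with its matrix. Thus a tensor field is a
   function on [M], whose smoothness has to be tested in the charts of the
   atlas, since [chart_at p] may vary wildly with [p]. Fields on an open set
   [U] are total functions of which only the values on [U] are used. *)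

Section tensors.
Context {R : realType} {n : nat} {M : smooth_manifold R n}.

Definition vector_field := M -> 'rV[R]_n.
Definition one_form := M -> 'rV[R]_n.
Definition bilinear_field := M -> 'M[R]_n.

Implicit Types (U : set M) (f h : M -> R) (X Y : vector_field).
Implicit Types (a b : one_form) (g P Q : bilinear_field).

Definition smooth_function U f : Prop :=
  forall c, atlas c -> smooth_rV (fwd c @` (U `&` dom c)) (f \o bwd c).

Definition pairing (a v : 'rV[R]_n) : R := (v *m a^T) 0 0.

Definition bilin (B : 'M[R]_n) (u v : 'rV[R]_n) : R := (u *m B *m v^T) 0 0.

Definition diff f : one_form := fun p =>
  \row_j 'D_(delta_mx 0 j) (f \o bwd (chart_at p)) (fwd (chart_at p) p).

Definition act X f : M -> R := fun p => pairing (diff f p) (X p).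

Definition coord (c : chart R n M) (i : 'I_n) : M -> R := fun q => fwd c q 0 i.

(* The vector field [d/dx^j] of the chart [c], on [dom c]. *)
Definition coord_field (c : chart R n M) (j : 'I_n) : vector_field := fun q =>
  'D_(delta_mx 0 j) (fwd (chart_at q) \o bwd c) (fwd c q).

Definition smooth_vector_field U X : Prop :=
  forall c, atlas c -> forall i,
    smooth_function (U `&` dom c) (act X (coord c i)).

Definition smooth_one_form U a : Prop :=
  forall c, atlas c -> forall i,
    smooth_function (U `&` dom c) (fun q => pairing (a q) (coord_field c i q)).

(* [X, Y] f = X (Y f) - Y (X f), for f a coordinate function at p. *)
Definition lie_bracket X Y : vector_field := fun p =>
  \row_j (act X (act Y (coord (chart_at p) j)) p
          - act Y (act X (coord (chart_at p) j)) p).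

(* (L_X a)(Y) = X (a Y) - a [X, Y], for Y a coordinate field at p. *)
Definition lie_one_form X a : one_form := fun p =>
  \row_j (let Y := coord_field (chart_at p) j in
          act X (fun q => pairing (a q) (Y q)) p
          - pairing (a p) (lie_bracket X Y p)).

(* (L_X P)(a, b) = X (P (a, b)) - P (L_X a, b) - P (a, L_X b), for a and b
   differentials of coordinate functions at p. *)
Definition lie_bivector X P : bilinear_field := fun p =>
  \matrix_(i, j)
    (let a := diff (coord (chart_at p) i) in
     let b := diff (coord (chart_at p) j) in
     act X (fun q => bilin (P q) (a q) (b q)) p
     - bilin (P p) (lie_one_form X a p) (b p)
     - bilin (P p) (a p) (lie_one_form X b p)).

(** * Poisson tensors *)

Definition smooth_bivector_field P : Prop :=
  (forall p, (P p)^T = - P p) /\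
  forall c, atlas c -> forall i j,
    smooth_function (dom c)
      (fun q => bilin (P q) (diff (coord c i) q) (diff (coord c j) q)).

(* The biderivation (f, h) |-> P (df, dh) associated to a bivector field. *)
Definition biderivation P f h : M -> R :=
  fun q => bilin (P q) (diff f q) (diff h q).

(* The Schouten-Nijenhuis bracket of two bivector fields is the triderivation
     [P, Q](f1, f2, f3) = sum over the circular permutations of (f1, f2, f3) of
       P (Q (f1, f2), f3) + Q (P (f1, f2), f3);
   here are its components in the chart [chart_at p]. *)
Definition schouten P Q (p : M) (i j k : 'I_n) : R :=
  let x := coord (chart_at p) in
  let term u v w := biderivation P (biderivation Q (x u) (x v)) (x w) p
                    + biderivation Q (biderivation P (x u) (x v)) (x w) p in
  term i j k + term j k i + term k i j.

Definition poisson_tensor P : Prop :=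
  smooth_bivector_field P /\ forall p i j k, schouten P P p i j k = 0.

Definition regular P : Prop := exists r : nat, forall p, \rank (P p) = r.

(* b (anchor P p a) = P (a, b) *)
Definition anchor P (p : M) (a : 'rV[R]_n) : 'rV[R]_n := a *m P p.

Definition sharp P a : vector_field := fun p => anchor P p (a p).

Definition koszul_bracket P a b : one_form := fun p =>
  lie_one_form (sharp P a) b p - lie_one_form (sharp P b) a p
  - diff (fun q => bilin (P q) (a q) (b q)) p.

Definition casimir P U f : Prop :=
  smooth_function U f /\ forall p, U p -> anchor P p (diff f p) = 0.

(* The symplectic foliation enters only through its tangent distribution, the
   image of the anchor. *)
Definition tangent_to_leaves P U Y : Prop :=
  forall p, U p -> exists a0 : 'rV[R]_n, Y p = anchor P p a0.

Definition foliated P U X : Prop :=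
  forall Y, smooth_vector_field U Y -> tangent_to_leaves P U Y ->
    tangent_to_leaves P U (lie_bracket X Y).

Definition poisson_vector_field P U X : Prop :=
  forall p, U p -> lie_bivector X P p = 0.

(** * Riemannian metrics *)

Definition riemannian_metric g : Prop :=
  [/\ forall p, (g p)^T = g p,
      forall p (v : 'rV[R]_n), v != 0 -> 0 < bilin (g p) v v &
      forall c, atlas c -> forall i j,
        smooth_function (dom c)
          (fun q => bilin (g q) (coord_field c i q) (coord_field c j q))].

Definition cometric g a b : M -> R :=
  fun q => bilin (invmx (g q)) (a q) (b q).

Definition perpendicular g P U X : Prop :=
  forall Y, smooth_vector_field U Y -> tangent_to_leaves P U Y ->
    forall p, U p -> bilin (g p) (X p) (Y p) = 0.

Definition bundle_like g P : Prop :=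
  forall U, open U -> forall X Y,
    smooth_vector_field U X -> smooth_vector_field U Y ->
    foliated P U X -> foliated P U Y ->
    perpendicular g P U X -> perpendicular g P U Y ->
    casimir P U (fun p => bilin (g p) (X p) (Y p)).

(** * Contravariant connections *)

(* [D] acts on smooth global one-forms; its values on other functions
   [M -> 'rV[R]_n] are irrelevant. *)
Record metric_contravariant_connection g P
    (D : one_form -> one_form -> one_form) : Prop := {
  connection_smooth : forall a b,
    smooth_one_form setT a -> smooth_one_form setT b ->
    smooth_one_form setT (D a b);
  connection_linear_l : forall f a a' b, smooth_function setT f ->
    smooth_one_form setT a -> smooth_one_form setT a' ->
    smooth_one_form setT b -> forall p,
    D (fun q => f q *: a q + a' q) b p = f p *: D a b p + D a' b p;
  connection_linear_r : forall (k : R) a b b',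
    smooth_one_form setT a -> smooth_one_form setT b ->
    smooth_one_form setT b' -> forall p,
    D a (fun q => k *: b q + b' q) p = k *: D a b p + D a b' p;
  connection_leibniz : forall f a b, smooth_function setT f ->
    smooth_one_form setT a -> smooth_one_form setT b -> forall p,
    D a (fun q => f q *: b q) p = f p *: D a b p + act (sharp P a) f p *: b p;
  connection_metric : forall a b b',
    smooth_one_form setT a -> smooth_one_form setT b ->
    smooth_one_form setT b' -> forall p,
    act (sharp P a) (cometric g b b') p
    = cometric g (D a b) b' p + cometric g b (D a b') p;
  connection_torsion_free : forall a b,
    smooth_one_form setT a -> smooth_one_form setT b -> forall p,
    D a b p - D b a p = koszul_bracket P a b p }.

(* For a covector [a0] at [p], [D_a0 b] is the value at [p] of [D a b] for any
   one-form [a] extending [a0]. *)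
Definition F_connection P (D : one_form -> one_form -> one_form) : Prop :=
  forall (p : M) (a0 : 'rV[R]_n), anchor P p a0 = 0 ->
    forall a b, smooth_one_form setT a -> smooth_one_form setT b ->
      a p = a0 -> D a b p = 0.

End tensors.

Arguments vector_field {R n} M.
Arguments one_form {R n} M.
Arguments bilinear_field {R n} M.

(* Main.v *)
From HB Require Import structures.
From mathcomp Require Import all_boot all_order all_algebra.
From mathcomp Require Import all_classical all_reals all_analysis.
From mathcomp Require Import ring.
Require Import Defs.

(** The one-form dual to a field perpendicular to the leaves annihilates them:
    it lies in the kernel [K] of the anchor. For a form [al] with values in [K],
    the hypothesis on the connection gives [D_al b = 0] for every [b], and
    torsion-freeness turns [D_b al] into the Lie derivative of [al] along the
    field [P b] (lemma [connection_kernel]). Both statements follow from this.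

    The metric is bundle-like. Let [X], [Y] be foliated and perpendicular, [al],
    [be] their dual forms, and [T = P b]. Metric compatibility gives
    [T g(X, Y) = <L_T al, be> + <al, L_T be>]. Now [<L_T al, be>] is
    [(L_T al)(Y) = T (al(Y)) - al([T, Y])], whose last term vanishes because
    [T, Y] is tangent to the leaves. So each of the two terms is [T g(X, Y)],
    which must be 0 (lemma [metric_bundle_like]).

    Poisson fields are foliated. If [L_X P = 0] then [X, P b] is [P (L_X b)],
    hence tangent to the leaves; and as the rank is constant, Cramer's formulas
    write every tangent field locally as [P b], up to a factor without zeros
    (lemmas [tangent_preimage] and [poisson_foliated]).

    Perpendicular foliated fields are Poisson. For [X] perpendicular with dual
    form [al], the Koszul formula reads
    [(L_X P)(b, c) = <b, D_c al> - <c, D_b al>] (lemma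
    [lie_bivector_connection]). The Jacobi identity shows that [D_b al] is again
    in [K] (lemma [lie_bivector_hamiltonian]), and as [X] is foliated, [K] is in
    the kernel of [L_X P]. So [L_X P] only matters on the orthogonal complement
    of [K], where the formula gives 0; the lemma [antisym_posdef_eq0] is the
    corresponding matrix computation.

    All of this is checked at one point [p], in the preferred chart at [p], where
    the coordinate expressions of the Lie derivatives are products of matrices.
    The operators are of first order, so only 1-jets at [p] matter. The
    connection acts on global forms; local fields are made global by bump
    functions that have the 1-jet of the constant 1 at [p]. That requires the
    calculus of smooth functions on open sets of ['rV[R]_n], and the chain rule
    to pass from one chart to another. *)

Set Implicit Arguments.
Unset Strict Implicit.
Unset Printing Implicit Defensive.

Import Order.TTheory GRing.Theory Num.Theory.
Import numFieldNormedType.Exports.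

Local Open Scope classical_set_scope.
Local Open Scope ring_scope.

(** * Linear algebra *)

Section linear_algebra.
Context {R : realType} {n : nat}.
Implicit Types (A G Q S : 'M[R]_n) (u v w : 'rV[R]_n).

Lemma trmx11 (A : 'M[R]_1) : A^T = A.
Proof. by apply/matrixP => i j; rewrite !ord1 mxE. Qed.

Lemma addmx00 (A B : 'M[R]_1) : A 0 0 + B 0 0 = (A + B) 0 0.
Proof. by rewrite mxE. Qed.

Lemma bilin_rows (A B C : 'M[R]_n) i j :
  (A *m B *m C^T) i j = bilin B (row i A) (row j C).
Proof.
rewrite /bilin tr_row -(row_mul i A B) [LHS]mxE [RHS]mxE; apply: eq_bigr => k _.
by rewrite [row _ _ _ _]mxE [col _ _ _ _]mxE.
Qed.

Lemma bilin_antisym A u v : A^T = - A -> bilin A u v = - bilin A v u.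
Proof.
move=> antiA; rewrite /bilin -[in LHS](trmx11 (u *m A *m v^T)).
by rewrite !trmx_mul trmxK antiA mulNmx mulmxN mxE mulmxA.
Qed.

Lemma bilin_sym A u v : A^T = A -> bilin A u v = bilin A v u.
Proof.
move=> symA; rewrite /bilin -[in LHS](trmx11 (u *m A *m v^T)).
by rewrite !trmx_mul trmxK symA mulmxA.
Qed.

Lemma pairingDl (u v w : 'rV[R]_n) : pairing (u + v) w = pairing u w + pairing v w.
Proof. by rewrite /pairing linearD mulmxDr mxE. Qed.

Lemma pairingZl k (u w : 'rV[R]_n) : pairing (k *: u) w = k * pairing u w.
Proof. by rewrite /pairing linearZ -scalemxAr mxE. Qed.

Lemma pairingBl u v w : pairing (u - v) w = pairing u w - pairing v w.
Proof. by rewrite pairingDl -scaleN1r pairingZl mulN1r. Qed.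

Lemma pairing0l (w : 'rV[R]_n) : pairing 0 w = 0.
Proof. by rewrite /pairing trmx0 mulmx0 mxE. Qed.

Lemma pairing0r u : pairing u 0 = 0.
Proof. by rewrite /pairing mul0mx mxE. Qed.

Lemma pairing_suml (I : Type) (r : seq I) (F : I -> 'rV[R]_n) w :
  pairing (\sum_(i <- r) F i) w = \sum_(i <- r) pairing (F i) w.
Proof.
elim: r => [|i r IH]; first by rewrite !big_nil pairing0l.
by rewrite !big_cons pairingDl IH.
Qed.

Lemma antisym_mulmx0 m A (B : 'M[R]_(m, n)) :
  A^T = - A -> B *m A = 0 -> A *m B^T = 0.
Proof.
move=> antiA BA; apply: trmx_inj.
by rewrite trmx_mul trmxK antiA mulmxN BA oppr0 trmx0.
Qed.

Lemma pairing_kernel A u v : A^T = - A -> u *m A = 0 -> pairing u (v *m A) = 0.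
Proof.
move=> antiA uA.
by rewrite /pairing -mulmxA (antisym_mulmx0 antiA uA) mulmx0 mxE.
Qed.

Lemma kernel_pairing (A : 'M[R]_n) (a0 : 'rV[R]_n) : A^T = - A ->
  (forall b0 : 'rV[R]_n, pairing a0 (b0 *m A) = 0) -> a0 *m A = 0.
Proof.
move=> antiA H.
have Aa : A *m a0^T = 0.
  apply/row_matrixP => i; rewrite row0 rowE mulmxA.
  by apply/matrixP => j k; rewrite !ord1 [RHS]mxE; exact: H.
by apply: trmx_inj; rewrite trmx_mul antiA mulNmx Aa oppr0 trmx0.
Qed.

Lemma posdef_gram_eq0 (G N : 'M[R]_n) :
  (forall v : 'rV[R]_n, v != 0 -> 0 < bilin G v v) -> N *m G *m N^T = 0 -> N = 0.
Proof.
move=> posG NGN; apply/row_matrixP => i; rewrite row0; apply/eqP.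
by apply: contraT => /posG; rewrite -bilin_rows NGN mxE ltxx.
Qed.

(** The relation makes [- Q / 2] the antisymmetric part of [S *m invmx G]. When
    it is substituted for the first factor of [Q G Q], the term in [S Q] drops
    out, and a further factor [Q G] meets [Q S^T = 0]. So [Q G Q G Q = 0], and
    positivity removes the factors [Q G] one after the other. *)
Lemma antisym_posdef_eq0 (G Q S : 'M[R]_n) : G^T = G ->
  (forall v : 'rV[R]_n, v != 0 -> 0 < bilin G v v) -> G \in unitmx ->
  Q^T = - Q -> S *m Q = 0 -> Q = invmx G *m S^T - S *m invmx G -> Q = 0.
Proof.
move=> symG posG uG antiQ SQ eQ.
have QS : Q *m S^T = 0 := antisym_mulmx0 antiQ SQ.
have QGQ : Q *m G *m Q = invmx G *m S^T *m G *m Q.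
  by rewrite {1}eQ !mulmxBl -[S *m _ *m G]mulmxA mulVmx // mulmx1 SQ subr0.
have QGQGQ : Q *m G *m (Q *m G *m Q) = 0.
  by rewrite QGQ !mulmxA -[Q *m G *m _]mulmxA mulmxV // mulmx1 QS !mul0mx.
have QGQ0 : Q *m G *m Q = 0.
  apply: (posdef_gram_eq0 posG).
  have -> : (Q *m G *m Q)^T = Q *m G *m Q.
    by rewrite !trmx_mul antiQ symG !(mulmxN, mulNmx) opprK mulmxA.
  by rewrite -[Q *m G *m Q *m G]mulmxA -mulmxA QGQGQ mulmx0.
by apply: (posdef_gram_eq0 posG); rewrite antiQ mulmxN QGQ0 oppr0.
Qed.

Lemma full_minor (A : 'M[R]_n) : exists f g : 'I_(\rank A) -> 'I_n,
  mxsub f g A \in unitmx.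
Proof.
pose A1 := rowsub (maxrankfun A) A.
have fA1 : row_full A1^T.
  by rewrite /row_full mxrank_tr; exact: maxrowsub_free.
exists (maxrankfun A), (fullrankfun fA1).
rewrite -unitmx_tr -row_full_unit.
rewrite (_ : _^T = rowsub (fullrankfun fA1) A1^T); first exact: fullrowsub_full.
by apply/matrixP => i j; rewrite !mxE.
Qed.

(** Cramer's formulas recover the vectors of the row space of [A] from their
    coordinates in the columns of an [r]-minor. The factor [det ^+ 2] makes the
    formula polynomial, and true also where the minor vanishes. *)
Lemma cramer_preimage r (f g : 'I_r -> 'I_n) (A : 'M[R]_n) (y : 'rV[R]_n) :
  (\rank A <= r)%N -> (y <= A)%MS ->
  (\det (mxsub f g A) *:
     (colsub g y *m \adj (mxsub f g A) *m rowsub f 1%:M)) *m A =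
  \det (mxsub f g A) ^+ 2 *: y.
Proof.
move=> rA yA; set B := mxsub f g A; have [d0|dN0] := eqVneq (\det B) 0.
  by rewrite d0 expr2 mul0r !scale0r mul0mx.
have uB : B \in unitmx by rewrite unitmxE unitfE.
have AfA : (rowsub f A <= A)%MS by exact: rowsub_sub.
have rf : \rank (rowsub f A) = r.
  apply/eqP; rewrite eqn_leq rank_leq_row.
  have rB : (r <= \rank B)%N by rewrite mxrank_unit.
  apply: leq_trans rB _.
  have -> : B = rowsub f A *m colsub g 1%:M.
    by apply/matrixP => i j; rewrite mulmx_colsub mulmx1 !mxE.
  exact: mxrankM_maxl.
have : (y <= rowsub f A)%MS.
  apply: submx_trans yA _.
  by rewrite -(mxrank_leqif_sup AfA) rf eqn_leq rA -{1}rf mxrankS.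
case/submxP => z yE.
have yg : colsub g y = z *m B.
  rewrite yE; apply/rowP => j; rewrite !mxE; apply: eq_bigr => k _.
  by rewrite !mxE.
rewrite yg -[z *m B *m _]mulmxA mul_mx_adj mul_mx_scalar -!scalemxAl -mulmxA.
have -> : rowsub f 1%:M *m A = rowsub f A.
  by apply/row_matrixP => i; rewrite row_mul !row_rowsub -row_mul mul1mx.
by rewrite -yE scalerA expr2.
Qed.

End linear_algebra.

(** * Calculus in several variables *)

Section calculus.
Context {R : realType} {n : nat}.
Implicit Types (A : set 'rV[R]_n) (f h : 'rV[R]_n -> R).

Notation e_ i := (delta_mx 0 i : 'rV[R]_n).

Lemma near_open A (P : 'rV[R]_n -> Prop) x :
  open A -> A x -> (forall y, A y -> P y) -> \forall y \near x, P y.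
Proof.
move=> oA Ax AP; have : nbhs x A by exact: open_nbhs_nbhs.
by apply: filterS.
Qed.

Lemma continuous_rV (T : topologicalType) (phi : T -> 'rV[R]_n) t :
  (forall i, {for t, continuous (fun s => phi s 0 i)}) -> {for t, continuous phi}.
Proof.
move=> ct; apply/cvgrPdist_le => /= e e0; near=> s.
rewrite /Num.Def.normr/= mx_normrE (bigmax_le _ (ltW e0))//= => -[i j] _ /=.
rewrite !mxE ord1; move: j {i}; near: s; apply: filter_forall => j.
exact: (cvgrPdist_le _ _).1 (ct j) _ e0.
Unshelve. all: by end_near. Qed.

Lemma continuous_sum_at (T : topologicalType) (I : Type) (r : seq I)
    (F : I -> T -> R) t :
  (forall i, {for t, continuous (F i)}) ->
  {for t, continuous (fun s => \sum_(i <- r) F i s)}.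
Proof. by move=> cF; apply: cvg_big => [|i _]; [exact: add_continuous | exact: cF]. Qed.

Lemma derivable_line f x (v : 'rV[R]_n) t :
  derivable f (x + t *: v) v ->
  is_derive t 1 (fun s => f (x + s *: v)) ('D_v f (x + t *: v)).
Proof.
rewrite /derivable => df.
suff E : (fun h : R => h^-1 *: (((fun s => f (x + s *: v)) \o shift t) (h *: 1)
      - f (x + t *: v))) =
     (fun h : R => h^-1 *: ((f \o shift (x + t *: v)) (h *: v) - f (x + t *: v))).
  by split; rewrite /derivable /derive E.
apply/funext => h /=; congr (_ *: (f _ - _)).
by rewrite [h%:A]mulr1 scalerDl addrCA.
Qed.

(** The increment [b] may be negative, hence the bounds on absolute values. *)
Lemma segment_increment f (x v : 'rV[R]_n) (b : R) :
  (forall t, `|t| <= `|b| -> derivable f (x + t *: v) v) ->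
  exists2 t, `|t| <= `|b| & f (x + b *: v) - f x = b * 'D_v f (x + t *: v).
Proof.
move=> df.
pose F s := f (x + s *: v).
have dF t : `|t| <= `|b| -> is_derive t (1 : R) F ('D_v f (x + t *: v)).
  by move=> tb; apply: derivable_line; apply: df.
have cF t : `|t| <= `|b| -> {for t, continuous F}.
  move=> tb; apply: differentiable_continuous; apply/derivable1_diffP.
  by have [] := dF _ tb.
have cW u w : (forall t, t \in `[u, w]%R -> `|t| <= `|b|) ->
   {within `[u, w], continuous F}.
  move=> H; apply: continuous_in_subspaceT => t; rewrite inE => tuw.
  by apply: cF; apply: H.
have F0 : F 0 = f x by rewrite /F scale0r addr0.
have [b0|b0] := leP 0 b.
- have H t : t \in `[0, b]%R -> `|t| <= `|b|.
    by rewrite in_itv /= => /andP[t0 tb]; rewrite !ger0_norm.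
  have [|t /H tb] := @MVT_segment _ F (fun s => 'D_v f (x + s *: v)) _ _ b0 _ (cW _ _ H).
    move=> t; rewrite in_itv /= => /andP[/ltW t0 /ltW tb].
    by apply: dF; apply: H; rewrite in_itv /= t0.
  by rewrite F0 subr0 mulrC => E; exists t.
- have H t : t \in `[b, 0]%R -> `|t| <= `|b|.
    by rewrite in_itv /= => /andP[t0 tb]; rewrite !ler0_norm ?lerN2 // ltW.
  have [|t /H tb] :=
    @MVT_segment _ F (fun s => 'D_v f (x + s *: v)) _ _ (ltW b0) _ (cW _ _ H).
    move=> t; rewrite in_itv /= => /andP[/ltW t0 /ltW tb].
    by apply: dF; apply: H; rewrite in_itv /= t0.
  rewrite F0 sub0r mulrN mulrC => E; exists t => //.
  by apply/eqP; rewrite -eqr_opp opprB; apply/eqP.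
Qed.

(** The vertices of the staircase that joins 0 to [v] along the coordinate axes. *)
Definition trunc_rV (k : nat) (v : 'rV[R]_n) : 'rV[R]_n :=
  \row_j (if (j < k)%N then v 0 j else 0).

Lemma norm_coord (v : 'rV[R]_n) j : `|v 0 j| <= `|v|.
Proof.
rewrite [leRHS]/Num.Def.normr/= mx_normrE.
exact: (le_bigmax _ _ (0, j)).
Qed.

Lemma norm_rV_le (v : 'rV[R]_n) e :
  0 <= e -> (forall j, `|v 0 j| <= e) -> `|v| <= e.
Proof.
move=> e0 H; rewrite /Num.Def.normr/= mx_normrE (bigmax_le _ e0)//= => -[i j] _.
by rewrite ord1.
Qed.

Definition gradient f x : 'rV[R]_n -> R := fun v => \sum_i v 0 i * partial i f x.

Lemma gradient_is_linear f x : linear (gradient f x).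
Proof.
move=> a u v; rewrite /gradient scaler_sumr -big_split /=; apply: eq_bigr => i _.
by rewrite !mxE mulrDl scalerAl.
Qed.

HB.instance Definition _ f x :=
  GRing.isLinear.Build R 'rV[R]_n R _ (gradient f x) (gradient_is_linear f x).

Lemma gradient_continuous f x : continuous (gradient f x).
Proof.
move=> v; apply: continuous_sum_at => i.
apply: continuousM; [exact: coord_continuous | exact: cst_continuous].
Qed.

(** Along each step of the staircase the increment of [f] is a partial derivative
    at an intermediate point, which continuity compares with its value at [x]. *)
Lemma C1_increment f x A eps : open A -> A x -> 0 < eps ->
  (forall y i, A y -> derivable f y (e_ i)) ->
  (forall i, {for x, continuous (partial i f)}) ->
  \forall v \near (0 : 'rV[R]_n), `|f (x + v) - f x - gradient f x v| <= eps * `|v|.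
Proof.
move=> oA Ax eps0 df cdf.
pose e' := eps / n.+1%:R.
have e'0 : 0 < e' by rewrite divr_gt0.
have : \forall y \near x, A y /\ forall i, `|partial i f x - partial i f y| <= e'.
  near=> y; split; first by near: y; exact: open_nbhs_nbhs.
  near: y; apply: filter_forall => i.
  exact: (cvgrPdist_le _ _).1 (cdf i) _ e'0.
move=> /nbhs_normP[/= r r0 Hr]; near=> v.
have vr : `|v| < r.
  by near: v; exact: (@pseudometric_normed_Zmodule.nbhs0_lt R 'rV[R]_n r r0).
have Hw w : `|w| <= `|v| ->
    A (x + w) /\ forall i, `|partial i f x - partial i f (x + w)| <= e'.
  move=> wv; apply: Hr; rewrite /= opprD addNKr normrN.
  exact: le_lt_trans wv vr.
have T0 : trunc_rV 0 v = 0 by apply/rowP => j; rewrite !mxE.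
have Tn : trunc_rV n v = v by apply/rowP => j; rewrite !mxE ltn_ord.
have TS (k : 'I_n) : trunc_rV k.+1 v = trunc_rV k v + v 0 k *: e_ k.
  apply/rowP => j; rewrite !mxE eqxx /= ltnS leq_eqVlt.
  have [<-|jk] := eqVneq k j.
    by rewrite eqxx /= ltnn mulr1 add0r.
  rewrite (_ : ((j : nat) == k) = false) ?orFb /=; last first.
    by apply/negbTE; rewrite eq_sym; apply: contra jk => /eqP /val_inj ->.
  by rewrite mulr0 addr0.
have -> : f (x + v) - f x = \sum_(k < n) (f (x + trunc_rV k.+1 v) - f (x + trunc_rV k v)).
  rewrite -{1}Tn -[x in - f x]addr0 -T0.
  by rewrite -(telescope_sumr (fun k => f (x + trunc_rV k v)) (leq0n n)) big_mkord.
rewrite /gradient -sumrB.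
apply: le_trans (ler_norm_sum _ _ _) _.
apply: (@le_trans _ _ (\sum_(k < n) (`|v| * e'))); last first.
  rewrite sumr_const card_ord -mulr_natr -mulrA mulrC ler_wpM2r // /e' -mulrA.
  by rewrite (ler_piMr (ltW eps0)) // mulrC ler_pdivrMr // mul1r ler_nat.
apply: ler_sum => k _.
rewrite TS addrA.
have tk t : `|t| <= `|v 0 k| -> `|trunc_rV k v + t *: e_ k| <= `|v|.
  move=> tv; apply: norm_rV_le => // j; rewrite !mxE eqxx /=.
  have [<-|jk] := eqVneq k j.
    by rewrite ltnn mulr1 add0r (le_trans tv) // norm_coord.
  rewrite mulr0 addr0.
  by case: ifP => _; rewrite ?normr0 ?norm_coord.
have [|t tv ->] := @segment_increment f (x + trunc_rV k v) (e_ k) (v 0 k).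
  move=> t tv; apply: df; rewrite -addrA; exact: (Hw _ (tk _ tv)).1.
rewrite -mulrBr normrM; apply: ler_pM => //; first exact: norm_coord.
by rewrite distrC -addrA; exact: (Hw _ (tk _ tv)).2.
Unshelve. all: by end_near. Qed.

Lemma C1_differentiable f x A : open A -> A x ->
  (forall y i, A y -> derivable f y (e_ i)) ->
  (forall i, {for x, continuous (partial i f)}) ->
  differentiable f x.
Proof.
move=> oA Ax df cdf.
have E : f \o shift x = cst (f x) + gradient f x +o_ (0 : 'rV[R]_n) id.
  apply/eqaddoP => _/posnumP[eps].
  have := C1_increment oA Ax [gt0 of eps%:num] df cdf.
  apply: filterS => v; rewrite -[(_ - _ : _ -> _) _]/(_ - _) /=.
  rewrite -[(cst _ + _ : _ -> _) _]/(_ + _) /= opprD addrA.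
  by rewrite [v + x]addrC.
apply/diff_locallyP; rewrite (diff_unique (@gradient_continuous f x) E).
by split; first exact: gradient_continuous.
Qed.

End calculus.

Section chain_rule.
Context {R : realType} {m n : nat}.
Implicit Types (f : 'rV[R]_n -> R) (phi : 'rV[R]_m -> 'rV[R]_n).

Lemma derive_line (W : normedModType R) (f : 'rV[R]_m -> W) x v :
  'D_v f x = 'D_1 (fun h : R => f (h *: v + x)) 0.
Proof.
rewrite /derive; set g1 := fun h => h^-1 *: _; set g2 := fun h => h^-1 *: _.
suff -> : g1 = g2 by [].
apply/funext => h; rewrite /g1 /g2 /=.
by rewrite addr0 scale0r add0r [h%:A]mulr1.
Qed.

Lemma diff_partial f y w : differentiable f y ->
  'd f y w = \sum_i w 0 i * partial i f y.
Proof.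
move=> df; rewrite {1}[w]row_sum_delta linear_sum /=; apply: eq_bigr => i _.
by rewrite linearZ /= /partial deriveE.
Qed.

(** Only the restriction of [phi] to a line matters: hence the asymmetry between
    the hypotheses on [f] and [phi]. *)
Lemma is_derive_comp f phi x v :
  differentiable f (phi x) -> derivable phi x v ->
  is_derive x v (f \o phi)
    (\sum_i 'D_v (fun y => phi y 0 i) x * partial i f (phi x)).
Proof.
move=> df dphi.
pose gam := fun h : R => phi (h *: v + x).
have g0 : gam 0 = phi x by rewrite /gam scale0r add0r.
have dgam : differentiable gam 0.
  by apply/derivable1_diffP; move/derivable1P: dphi.
have dfg : differentiable (f \o gam) 0.
  by apply: differentiable_comp => //; rewrite g0.
have dg : 'D_v phi x = 'd gam 0 1 by rewrite -deriveE //; exact: derive_line.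
have dfg1 : derivable (f \o gam) 0 1 by apply/derivable1_diffP.
split; first by apply/derivable1P; exact: dfg1.
transitivity ('D_1 (f \o gam) 0); first exact: derive_line.
rewrite deriveE // (diff_comp dgam _) ?g0 // [LHS]/= -dg diff_partial //.
by apply: eq_bigr => i _; rewrite derive_mx // mxE.
Qed.

End chain_rule.

(** * Functions of class C^k *)

Section Ck.
Context {R : realType}.

Notation e_ i := (delta_mx 0 i).

(** Classes of finite order make smoothness accessible to induction: it amounts
    to being of class C^k for all k. *)
Fixpoint Ck n (A : set 'rV[R]_n) k (f : 'rV[R]_n -> R) : Prop :=
  (forall x, A x -> {for x, continuous f}) /\
  if k is k'.+1 then
    forall i, (forall x, A x -> derivable f x (e_ i)) /\ Ck A k' (partial i f)
  else True.

Section one_dimension.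
Context {n : nat}.
Implicit Types (A : set 'rV[R]_n) (f h : 'rV[R]_n -> R).

Lemma foldr_partial_rcons s (i : 'I_n) f :
  foldr partial f (rcons s i) = foldr partial (partial i f) s.
Proof. by rewrite foldr_rcons. Qed.

Lemma smooth_partial A f i : smooth_rV A f -> smooth_rV A (partial i f).
Proof. by move=> sf s x Ax; rewrite -foldr_partial_rcons; exact: sf. Qed.

(** In an iterated partial derivative the innermost derivation is the last of the
    list, hence the induction from the right. *)
Lemma smooth_rV_Ck A f : smooth_rV A f <-> forall k, Ck A k f.
Proof.
split=> [sf k|H s].
  elim: k f sf => [|k IH] f sf; split => //.
  - by move=> x Ax; exact: (sf [::] x Ax).1.
  - by move=> x Ax; exact: (sf [::] x Ax).1.
  - move=> i; split; last by apply: IH; exact: smooth_partial.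
    by move=> x Ax; exact: (sf [::] x Ax).2.
elim/last_ind: s f H => [|s i IH] f H x Ax.
  by have [c d] := H 1%N; split=> [|i]; [exact: c | exact: (d i).1].
rewrite foldr_partial_rcons; apply: IH => // k.
by have [_ d] := H k.+1; exact: (d i).2.
Qed.

Lemma near_eq_for_continuous (T U : topologicalType) (f h : T -> U) x :
  (\near x, f x = h x) -> {for x, continuous f} -> {for x, continuous h}.
Proof.
move=> fh cf; have cfh : f y @[y --> x] --> h x by rewrite -(nbhs_singleton fh).
by apply: cvg_trans cfh; apply: near_eq_cvg; apply: filterS fh.
Qed.

Lemma eq_Ck A k f h : open A -> (forall x, A x -> f x = h x) ->
  Ck A k f -> Ck A k h.
Proof.
move=> oA; elim: k f h => [|k IH] f h fh.
  move=> [cf _]; split => // x Ax.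
  by apply: near_eq_for_continuous (cf x Ax); apply: near_open oA Ax fh.
move=> [cf df]; split.
  move=> x Ax; apply: near_eq_for_continuous (cf x Ax).
  exact: near_open oA Ax fh.
move=> i; split=> [x Ax|].
  by apply: near_eq_derivable ((df i).1 x Ax); apply: near_open oA Ax fh.
apply: (IH (partial i f)); last exact: (df i).2.
by move=> x Ax; apply: near_eq_derive; apply: near_open oA Ax fh.
Qed.

Lemma Ck_pred A k f : Ck A k.+1 f -> Ck A k f.
Proof.
elim: k f => [|k IH] f [cf df]; split => // i.
by split; [exact: (df i).1 | apply: IH; exact: (df i).2].
Qed.

Lemma Ck_cst A k a : Ck A k (fun=> a).
Proof.
elim: k a => [|k IH] a; split => //; try by move=> x _; exact: cst_continuous.
move=> i; split=> [x _|]; first exact: derivable_cst.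
suff -> : partial i (fun=> a) = (fun=> 0) by exact: IH.
by apply/funext => x; rewrite /partial derive_cst.
Qed.

Lemma CkD A k f h : open A -> Ck A k f -> Ck A k h -> Ck A k (fun x => f x + h x).
Proof.
move=> oA; elim: k f h => [|k IH] f h [cf df] [ch dh]; split => //;
  try by move=> x Ax; apply: continuousD; [exact: cf | exact: ch].
move=> i; split=> [x Ax|].
  by apply: derivableD; [exact: (df i).1 | exact: (dh i).1].
apply: (@eq_Ck _ _ (fun x => partial i f x + partial i h x)) => //.
  by move=> x Ax; rewrite /partial deriveD //; [exact: (df i).1 | exact: (dh i).1].
by apply: IH; [exact: (df i).2 | exact: (dh i).2].
Qed.

Lemma CkM A k f h : open A -> Ck A k f -> Ck A k h -> Ck A k (fun x => f x * h x).
Proof.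
move=> oA; elim: k f h => [|k IH] f h Cf Ch; have [cf df] := Cf; have [ch dh] := Ch;
  split => //; try by move=> x Ax; apply: continuousM; [exact: cf | exact: ch].
move=> i; split=> [x Ax|].
  by apply: derivableM; [exact: (df i).1 | exact: (dh i).1].
apply: (@eq_Ck _ _ (fun x => f x * partial i h x + h x * partial i f x)) => //.
  by move=> x Ax; rewrite /partial deriveM //; [exact: (df i).1 | exact: (dh i).1].
by apply: CkD => //; apply: IH; [exact: Ck_pred | exact: (dh i).2
  | exact: Ck_pred | exact: (df i).2].
Qed.

Lemma Ck_sum A k (I : Type) (r : seq I) (F : I -> 'rV[R]_n -> R) : open A ->
  (forall i, Ck A k (F i)) -> Ck A k (fun x => \sum_(i <- r) F i x).
Proof.
move=> oA CF; elim: r => [|i r IH].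
  by apply: eq_Ck (Ck_cst A k 0) => // x _; rewrite big_nil.
apply: (@eq_Ck _ _ (fun x => F i x + \sum_(j <- r) F j x)) => //.
  by move=> x _; rewrite big_cons.
exact: CkD.
Qed.

Lemma Ck1_differentiable A f x : open A -> A x -> Ck A 1 f -> differentiable f x.
Proof.
move=> oA Ax [_ df]; apply: (C1_differentiable oA Ax).
  by move=> y i Ay; exact: (df i).1.
by move=> i; have [_ [c _]] := df i; exact: c.
Qed.

Lemma smooth_differentiable A f x : open A -> A x -> smooth_rV A f ->
  differentiable f x.
Proof. by move=> oA Ax /smooth_rV_Ck /(_ 1%N); exact: Ck1_differentiable. Qed.

End one_dimension.

(** The partial derivatives of the composite are sums of products of composites
    of a lower class. *)
Lemma Ck_comp m n (A : set 'rV[R]_m) (B : set 'rV[R]_n) k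
    (phi : 'rV[R]_m -> 'rV[R]_n) f :
  open A -> open B -> (forall x, A x -> B (phi x)) ->
  (forall i, Ck A k (fun x => phi x 0 i)) -> Ck B k f -> Ck A k (f \o phi).
Proof.
move=> oA oB AB; elim: k f => [|k IH] f Cphi Cf.
  split => // x Ax; apply: continuous_comp; last by apply: Cf.1; exact: AB.
  by apply: continuous_rV => i; exact: (Cphi i).1.
have Df x (Ax : A x) i : is_derive x (e_ i) (f \o phi)
    (\sum_j partial i (fun y => phi y 0 j) x * partial j f (phi x)).
  apply: is_derive_comp.
    apply: (Ck1_differentiable oB (AB x Ax)).
    by elim: {IH Cphi} k Cf => // k IH /Ck_pred.
  by apply/derivable_mxP => i' j; rewrite ord1; have [_ d] := Cphi j; exact: (d i).1.
split.
  move=> x Ax; apply: continuous_comp; last by apply: Cf.1; exact: AB.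
  by apply: continuous_rV => i; exact: (Cphi i).1.
move=> i; split=> [x Ax|]; first by have [] := Df x Ax i.
pose F j x := partial i (fun y => phi y 0 j) x * partial j f (phi x).
apply: (@eq_Ck _ _ _ (fun x => \sum_j F j x)) => //.
  by move=> x Ax; have [_ <-] := Df x Ax i.
apply: Ck_sum => // j; apply: CkM => //; first by have [_ d] := Cphi j; exact: (d i).2.
apply: IH => [l|]; first exact: Ck_pred.
by have [_ d] := Cf; exact: (d j).2.
Qed.

End Ck.

(** * Algebra of smooth functions *)

Section smooth.
Context {R : realType} {n : nat}.
Implicit Types (A B : set 'rV[R]_n) (f h : 'rV[R]_n -> R).

Lemma smooth_cst A a : smooth_rV A (fun=> a).
Proof. by apply/smooth_rV_Ck => k; exact: Ck_cst. Qed.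

Lemma smoothD A f h : open A -> smooth_rV A f -> smooth_rV A h ->
  smooth_rV A (fun x => f x + h x).
Proof.
by move=> oA /smooth_rV_Ck Cf /smooth_rV_Ck Ch; apply/smooth_rV_Ck => k; exact: CkD.
Qed.

Lemma smoothM A f h : open A -> smooth_rV A f -> smooth_rV A h ->
  smooth_rV A (fun x => f x * h x).
Proof.
by move=> oA /smooth_rV_Ck Cf /smooth_rV_Ck Ch; apply/smooth_rV_Ck => k; exact: CkM.
Qed.

Lemma eq_smooth A f h : open A -> (forall x, A x -> f x = h x) ->
  smooth_rV A f -> smooth_rV A h.
Proof.
by move=> oA fh /smooth_rV_Ck Cf; apply/smooth_rV_Ck => k; exact: eq_Ck (Cf k).
Qed.

Lemma smooth_subset A B f : A `<=` B -> smooth_rV B f -> smooth_rV A f.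
Proof. by move=> AB sf s x /AB; exact: sf. Qed.

Lemma smooth_comp A B (phi : 'rV[R]_n -> 'rV[R]_n) f : open A -> open B ->
  (forall x, A x -> B (phi x)) ->
  (forall i, smooth_rV A (fun x => phi x 0 i)) -> smooth_rV B f ->
  smooth_rV A (f \o phi).
Proof.
move=> oA oB AB sphi /smooth_rV_Ck Cf; apply/smooth_rV_Ck => k.
by apply: (Ck_comp oA oB AB) => // i; move/smooth_rV_Ck: (sphi i).
Qed.

Lemma smooth_derivable A f x v : open A -> A x -> smooth_rV A f -> derivable f x v.
Proof. by move=> oA Ax sf; apply/diff_derivable/(smooth_differentiable oA Ax). Qed.

End smooth.

(** * Flat functions and bumps *)

Section flat.
Context {R : realType}.
Implicit Types (p : {poly R}) (t : R).

(** The function [exp(-1/t)], extended by 0, is smooth because its derivatives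
    are again of this form, with a polynomial in [1/t] as an additional factor. *)
Definition flat p t : R := if 0 < t then p.[t^-1] * expR (- t^-1) else 0.

Lemma pow_le_expR (u : R) k : 0 <= u -> u ^+ k <= k`!%:R * expR u.
Proof.
move=> u0; have k0 : 0 < k`!%:R :> R by rewrite ltr0n fact_gt0.
rewrite mulrC -ler_pdivrMr //; case: k k0 => [|k] k0.
  by rewrite expr0 fact0 divr1 -expR0 ler_expR.
by apply: le_trans (expR_ge1Dxn k u0); rewrite lerDr.
Qed.

Lemma horner_le_expR p : exists2 C : R, 0 <= C &
  forall u, 0 <= u -> `|p.[u]| <= C * expR u.
Proof.
exists (\sum_(i < size p) `|p`_i| * i`!%:R).
  by apply: sumr_ge0 => i _; rewrite mulr_ge0.
move=> u u0; rewrite horner_coef (le_trans (ler_norm_sum _ _ _)) //.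
rewrite mulr_suml; apply: ler_sum => i _.
rewrite normrM -mulrA ler_wpM2l // normrX ger0_norm //; exact: pow_le_expR.
Qed.

Lemma flat_le_sqr p : exists2 C : R, 0 <= C & forall t, `|flat p t| <= C * t ^+ 2.
Proof.
have [C C0 HC] := horner_le_expR (p * 'X^2).
exists C => // t; rewrite /flat; case: ifPn => t0; last first.
  by rewrite normr0 mulr_ge0 // sqr_ge0.
have := HC t^-1; rewrite invr_ge0 ltW // => /(_ isT).
rewrite hornerM hornerXn normrM (ger0_norm (_ : 0 <= t^-1 ^+ 2)); last first.
  by rewrite exprn_ge0 // invr_ge0 ltW.
rewrite normrM (ger0_norm (expR_ge0 _)) expRN ler_pdivrMr ?expR_gt0 //.
rewrite exprVn ler_pdivrMr ?exprn_gt0 //.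
by rewrite mulrAC.
Qed.

(** Near 0 the flat functions are [O(t^2)], the exponential beating every power
    of [1/t]; hence they have a derivative there, which vanishes. *)
Lemma is_derive_flat p t : is_derive t (1 : R) (flat p) (flat ('X^2 * (p - p^`())) t).
Proof.
set q := 'X^2 * (p - p^`()).
have [t0|t0|<-] := ltgtP 0 t.
- apply: (@near_eq_is_derive R R R (fun s : R => p.[s^-1] * expR (- s^-1))).
    near=> s; rewrite /flat ifT //; near: s; exact: lt_nbhsr.
  have dV : is_derive t (1 : R) (fun s : R => s^-1) (- t ^- 2).
    apply: is_derive_eq; first by apply: is_deriveV; rewrite gt_eqF.
    by rewrite [_ *: 1]mulr1.
  have dN : is_derive t (1 : R) (fun s : R => - s^-1) (t ^- 2).
    by apply: is_derive_eq; rewrite opprK.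
  have dp : is_derive t (1 : R) (horner p \o (fun s : R => s^-1))
     (p^`().[t^-1] * - t ^- 2) :=
    is_derive1_comp (is_derive_poly p _) dV.
  have de : is_derive t (1 : R) (expR \o (fun s : R => - s^-1))
     (expR (- t^-1) * t ^- 2) :=
    is_derive1_comp (is_derive_expR _) dN.
  have dm := is_deriveM dp de.
  apply: (@is_derive_eq _ _ _ _ _ _ _ _ dm).
  rewrite /flat t0 /q hornerM hornerXn hornerD hornerN exprVn /=.
  rewrite -![_ *: _]/(_ * _); ring.
- apply: (@near_eq_is_derive R R R (cst 0)).
    near=> s; rewrite /flat ifF //; apply/negbTE; rewrite -leNgt ltW //.
    by near: s; exact: lt_nbhsl.
  by apply: is_derive_eq; rewrite /flat ltNge (ltW t0).
- have [C C0 HC] := flat_le_sqr p.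
  have lim0 : h^-1 *: ((flat p \o shift 0) (h *: 1) - flat p 0) @[h --> 0^'] --> (0 : R).
    apply/cvgr0Pnorm_le => e e0; near=> h.
    have h0 : h != 0 by near: h; exact: nbhs_dnbhs_neq.
    rewrite /= addr0 [_ *: 1]mulr1 {2}/flat ltxx subr0 [_ *: _]/(_ * _) normrM normfV.
    rewrite ler_pdivrMl ?normr_gt0 // (le_trans (HC h)) //.
    rewrite -real_normK ?num_real // expr2 mulrCA ler_wpM2l //.
    rewrite (@le_trans _ _ ((C + 1) * `|h|)) //; first by rewrite ler_wpM2r // lerDl.
    rewrite -ler_pdivlMl ?ltr_pwDr // ltW //; near: h; apply: dnbhs0_lt.
    by rewrite mulr_gt0 // invr_gt0 ltr_pwDr.
  have -> : flat q 0 = 0 by rewrite /flat ltxx.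
  by split; [apply/cvg_ex; exists 0 | apply/cvg_lim].
Unshelve. all: by end_near. Qed.

End flat.

Section flat_comp.
Context {R : realType} {n : nat}.
Notation e_ i := (delta_mx 0 i : 'rV[R]_n).

Lemma is_derive_comp_real (f : R -> R) (h : 'rV[R]_n -> R) x v df :
  derivable h x v -> is_derive (h x) 1 f df ->
  is_derive x v (f \o h) ('D_v h x * df).
Proof.
move=> dh [f1 fE].
pose gam := fun s : R => h (s *: v + x).
have g0 : gam 0 = h x by rewrite /gam scale0r add0r.
have dgam1 : derivable gam 0 1 by move/derivable1P: dh.
have df1 : derivable f (gam 0) 1 by rewrite g0; exact: f1.
have dgam : differentiable gam 0 by apply/derivable1_diffP; exact: dgam1.
have dff : differentiable f (gam 0) by apply/derivable1_diffP.
have dfg : differentiable (f \o gam) 0 by exact: differentiable_comp.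
have dfg1 : derivable (f \o gam) 0 1 by apply/derivable1_diffP.
split; first by apply/derivable1P; exact: dfg1.
transitivity ('D_1 (f \o gam) 0); first exact: derive_line.
rewrite -derive1E (derive1_comp dgam1 df1) [LHS]mulrC; congr (_ * _).
  by rewrite derive1E; symmetry; exact: derive_line.
by rewrite derive1E g0.
Qed.

Lemma smooth_flat (A : set 'rV[R]_n) p h : open A -> smooth_rV A h ->
  smooth_rV A (flat p \o h).
Proof.
move=> oA sh; apply/smooth_rV_Ck => k; elim: k p => [|k IH] p.
all: have Df x i : A x -> is_derive x (e_ i) (flat p \o h)
   (partial i h x * flat ('X^2 * (p - p^`())) (h x)) by
  move=> Ax; apply: is_derive_comp_real (is_derive_flat _ _);
  exact: smooth_derivable sh.
all: have cf x : A x -> {for x, continuous (flat p \o h)} by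
  move=> Ax; apply: continuous_comp; [exact: (sh [::] x Ax).1|];
  apply: differentiable_continuous; apply/derivable1_diffP;
  have [] := is_derive_flat p (h x).
  by split.
split=> [|i]; first exact: cf.
split=> [x Ax|]; first by have [] := Df x i Ax.
have Cp : Ck A k (partial i h) by have /smooth_rV_Ck := smooth_partial i sh; apply.
apply: eq_Ck (CkM oA Cp (IH ('X^2 * (p - p^`())))) => // x Ax.
by have [_ E] := Df x i Ax; exact: esym E.
Qed.

Lemma is_derive_coord x v (i : 'I_n) :
  is_derive x v (fun y : 'rV[R]_n => y 0 i) (v 0 i).
Proof.
have did : derivable (fun y : 'rV[R]_n => y) x v := @derivable_id R _ x v.
split; first by move/derivable_mxP: did.
by have := derive_mx did; rewrite derive_id => /rowP /(_ i) ->; rewrite mxE.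
Qed.

Lemma smooth_coord (A : set 'rV[R]_n) i : open A -> smooth_rV A (fun y => y 0 i).
Proof.
move=> oA; apply/smooth_rV_Ck => -[|k]; split => //;
  try by move=> x _; exact: coord_continuous.
move=> j; split=> [x _|]; first by have [] := is_derive_coord x (e_ j) i.
apply: (@eq_Ck _ _ _ _ (fun=> e_ j 0 i)) => //; last exact: Ck_cst.
by move=> x _; have [_ <-] := is_derive_coord x (e_ j) i.
Qed.

Lemma smooth_sum (A : set 'rV[R]_n) (I : Type) (r : seq I) F : open A ->
  (forall i, smooth_rV A (F i)) -> smooth_rV A (fun x => \sum_(i <- r) F i x).
Proof.
move=> oA sF; apply/smooth_rV_Ck => k; apply: Ck_sum => // i.
by move/smooth_rV_Ck: (sF i).
Qed.

(** Positive on a Euclidean ball and polynomial, so that [flat 1 \o gap a r] is a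
    smooth bump supported in that ball. *)
Definition gap (a : 'rV[R]_n) (r : R) (x : 'rV[R]_n) : R :=
  r ^+ 2 - \sum_i (x 0 i - a 0 i) ^+ 2.

Lemma smooth_gap a r : smooth_rV setT (gap a r).
Proof.
apply: (@eq_smooth _ _ _ (fun x : 'rV[R]_n => r ^+ 2 + - 1 *
   \sum_i ((x 0 i + - a 0 i) * (x 0 i + - a 0 i)))); first exact: openT.
  by move=> x _; rewrite /gap mulN1r.
apply: smoothD; [exact: openT | exact: smooth_cst | apply: smoothM].
- exact: openT.
- exact: smooth_cst.
apply: smooth_sum => [|i]; first exact: openT.
have s : smooth_rV setT (fun x : 'rV[R]_n => x 0 i + - a 0 i).
  apply: smoothD; first exact: openT.
    by apply: smooth_coord; exact: openT.
  exact: smooth_cst.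
by apply: smoothM => //; exact: openT.
Qed.

Lemma partial_gap_center a r j : partial j (gap a r) a = 0.
Proof.
have H i : is_derive a (e_ j) (fun x : 'rV[R]_n => (x 0 i - a 0 i) ^+ 2) 0.
  have [d1 d2] := is_derive_coord a (e_ j) i.
  have db : derivable (fun x : 'rV[R]_n => x 0 i - a 0 i) a (e_ j).
    by apply: derivableB; [exact: d1 | exact: derivable_cst].
  split; first exact: (@derivableX _ _ _ 2 _ _ db).
  have -> : (fun x : 'rV[R]_n => (x 0 i - a 0 i) ^+ 2) =
     (fun x : 'rV[R]_n => (x 0 i - a 0 i) * (x 0 i - a 0 i)).
    by apply/funext => x; rewrite expr2.
  by rewrite deriveM // subrr !scale0r addr0.
rewrite /partial /gap deriveB; last 2 first.
- exact: derivable_cst.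
- have -> : (fun x : 'rV[R]_n => \sum_i (x 0 i - a 0 i) ^+ 2) =
    \sum_i (fun x : 'rV[R]_n => (x 0 i - a 0 i) ^+ 2).
    by apply/funext => x; rewrite fct_sumE.
  by apply: derivable_sum => i; have [] := H i.
rewrite derive_cst sub0r.
have -> : (fun x : 'rV[R]_n => \sum_i (x 0 i - a 0 i) ^+ 2) =
    \sum_i (fun x : 'rV[R]_n => (x 0 i - a 0 i) ^+ 2).
  by apply/funext => x; rewrite fct_sumE.
rewrite derive_sum; last by move=> i; have [] := H i.
by rewrite big1 ?oppr0 // => i _; have [] := H i.
Qed.

Lemma gap_norm (a x : 'rV[R]_n) r : 0 <= r -> 0 <= gap a r x -> `|x - a| <= r.
Proof.
move=> r0 gx; apply: norm_rV_le => // j.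
rewrite !mxE -(@ler_pXn2r _ 2) ?nnegrE // -normrX ger0_norm ?sqr_ge0 //.
move: gx; rewrite /gap subr_ge0; apply: le_trans.
by rewrite (bigD1 j) //= lerDl sumr_ge0 // => i _; exact: sqr_ge0.
Qed.

Lemma gap_compact a r : 0 <= r -> compact [set x | 0 <= gap a r x].
Proof.
move=> r0; apply: bounded_closed_compact.
  exists (`|a| + r); split; first exact: num_real.
  move=> M ltM x /= gx; apply: le_trans (ltW ltM).
  have -> : x = a + (x - a) by rewrite addrC subrK.
  apply: le_trans (ler_normD _ _) _; rewrite lerD2l.
  exact: gap_norm r0 gx.
have -> : [set x | 0 <= gap a r x] = gap a r @^-1` [set y | 0 <= y] by [].
apply: preimage_closed; first by move=> x _; exact: ((@smooth_gap a r) [::] x I).1.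
exact: closed_ge.
Qed.

End flat_comp.

(** * Charts *)

Section charts.
Context {R : realType} {n : nat} {M : smooth_manifold R n}.
Implicit Types (U V W Z : set M) (f h : M -> R) (c : chart R n M).

Notation e_ i := (delta_mx 0 i : 'rV[R]_n).

Lemma fwd_image_dom c (U : set M) x : U `<=` dom c -> (fwd c @` U) x ->
  U (bwd c x) /\ fwd c (bwd c x) = x.
Proof. by move=> Ud [q Uq <-]; rewrite fwdK //; exact: Ud. Qed.

Lemma image_open c U : open U -> U `<=` dom c -> open (fwd c @` U).
Proof.
move=> oU Ud; rewrite openE => _ [q Uq <-].
have cq : (fwd c @` dom c) (fwd c q) by exists q => //; exact: Ud.
have nU : \forall x \near fwd c q, U (bwd c x).
  apply: (bwd_continuous cq); rewrite fwdK; last exact: Ud.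
  exact: open_nbhs_nbhs.
have nd : nbhs (fwd c q) (fwd c @` dom c).
  by apply: open_nbhs_nbhs; split; [exact: cod_open|].
rewrite /interior; near=> x.
have [q' dq' q'x] : (fwd c @` dom c) x by near: x.
have Ux : U (bwd c x) by near: x.
by exists q' => //; move: Ux; rewrite -q'x fwdK.
Unshelve. all: by end_near. Qed.

Lemma openI_dom c U : open U -> open (U `&` dom c).
Proof. by move=> oU; apply: openI => //; exact: dom_open. Qed.

Lemma imageI_open c U : open U -> open (fwd c @` (U `&` dom c)).
Proof. by move=> oU; apply: image_open; [exact: openI_dom | exact: subIsetr]. Qed.

Lemma smooth_function_sub U V f : V `<=` U ->
  smooth_function U f -> smooth_function V f.
Proof.
move=> VU sf c ac; apply: smooth_subset (sf c ac).
by apply: image_subset; apply: setSI.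
Qed.

Lemma eq_smooth_function V f h : open V -> (forall q, V q -> f q = h q) ->
  smooth_function V f -> smooth_function V h.
Proof.
move=> oV fh sf c ac; apply: eq_smooth (sf c ac); first exact: imageI_open.
move=> x /(fwd_image_dom (@subIsetr _ _ _))[[Vx _] _]; exact: fh.
Qed.

Lemma smooth_function_cst V a : smooth_function V (fun=> a).
Proof. by move=> c ac; exact: smooth_cst. Qed.

Lemma smooth_functionD V f h : open V -> smooth_function V f ->
  smooth_function V h -> smooth_function V (fun q => f q + h q).
Proof.
by move=> oV sf sh c ac; exact: (smoothD (imageI_open (c := c) oV) (sf c ac) (sh c ac)).
Qed.

Lemma smooth_functionM V f h : open V -> smooth_function V f ->
  smooth_function V h -> smooth_function V (fun q => f q * h q).
Proof.
by move=> oV sf sh c ac; exact: (smoothM (imageI_open (c := c) oV) (sf c ac) (sh c ac)).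
Qed.

Lemma smooth_function_sum V (I : Type) (r : seq I) (F : I -> M -> R) : open V ->
  (forall i, smooth_function V (F i)) ->
  smooth_function V (fun q => \sum_(i <- r) F i q).
Proof.
move=> oV sF; elim: r => [|i r IH].
  apply: (@eq_smooth_function V (fun=> 0)) => //; last exact: smooth_function_cst.
  by move=> q _; rewrite big_nil.
apply: (@eq_smooth_function V (fun q => F i q + \sum_(j <- r) F j q)); first exact: oV.
  by move=> q _; rewrite big_cons.
exact: smooth_functionD oV (sF i) IH.
Qed.

Lemma smooth_function_prod V (I : Type) (r : seq I) (F : I -> M -> R) : open V ->
  (forall i, smooth_function V (F i)) ->
  smooth_function V (fun q => \prod_(i <- r) F i q).
Proof.
move=> oV sF; elim: r => [|i r IH].
  apply: (@eq_smooth_function V (fun=> 1)) => //; last exact: smooth_function_cst.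
  by move=> q _; rewrite big_nil.
apply: (@eq_smooth_function V (fun q => F i q * \prod_(j <- r) F j q)); first exact: oV.
  by move=> q _; rewrite big_cons.
exact: smooth_functionM oV (sF i) IH.
Qed.

Lemma smooth_functionU U V f :
  smooth_function U f -> smooth_function V f -> smooth_function (U `|` V) f.
Proof.
move=> sU sV c ac s x [q [[Uq|Vq] dq] <-].
  by apply: (sU c ac); exists q.
by apply: (sV c ac); exists q.
Qed.

(** Smoothness is a local property, and the domains of the atlas cover the
    manifold. *)
Lemma smooth_function_local V f :
  (forall c, atlas c -> smooth_function (V `&` dom c) f) -> smooth_function V f.
Proof.
move=> sf c ac s x [q [Vq dq] <-].
apply: (sf _ (@chart_at_atlas _ _ _ q) c ac); exists q => //.
by split=> //; split=> //; exact: chart_at_dom.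
Qed.

(** The transition maps are smooth by compatibility of the atlas. *)
Lemma smooth_function_chart c V F : atlas c -> open V -> V `<=` dom c ->
  smooth_rV (fwd c @` V) F -> smooth_function V (F \o fwd c).
Proof.
move=> ac oV Vd sF c' ac'.
have oA := imageI_open (c := c') oV.
apply: (@smooth_comp _ _ _ (fwd c @` V) (fwd c \o bwd c')) => //.
- exact: image_open.
- by move=> _ [q [Vq dq] <-] /=; rewrite fwdK //; exists q.
move=> i; apply: smooth_subset (atlas_compatible ac' ac i).
by apply: image_subset => q [Vq dq]; split => //; exact: Vd.
Qed.

Lemma smooth_coord_function c i : atlas c -> smooth_function (dom c) (coord c i).
Proof.
move=> ac c' ac'; rewrite setIC; exact: atlas_compatible.
Qed.

Lemma smooth_function_partial c V f j : atlas c -> open V -> V `<=` dom c ->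
  smooth_function V f ->
  smooth_function V (fun q => partial j (f \o bwd c) (fwd c q)).
Proof.
move=> ac oV Vd sf.
apply: (@smooth_function_chart c V (partial j (f \o bwd c))) => //.
by apply: smooth_partial; move: (sf c ac); rewrite (setIidl Vd).
Qed.

Lemma smooth_function_differentiable c V f q : atlas c -> open V -> V q -> dom c q ->
  smooth_function V f -> differentiable (f \o bwd c) (fwd c q).
Proof.
move=> ac oV Vq dq sf.
apply: (smooth_differentiable (imageI_open (c := c) oV) _ (sf c ac)).
by exists q.
Qed.

(** The chain rule: the differential, expressed in the preferred coordinates at
    [q], is compatible with the partial derivatives of any other chart. *)
Lemma diff_coord_field c V f j q : atlas c -> open V -> V q -> dom c q ->
  smooth_function V f ->
  pairing (diff f q) (coord_field c j q) = partial j (f \o bwd c) (fwd c q).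
Proof.
move=> ac oV Vq dq sf.
set c0 := chart_at q; have ac0 : atlas c0 by exact: chart_at_atlas.
have d0 : dom c0 q by exact: chart_at_dom.
have Df := smooth_function_differentiable ac0 oV Vq d0 sf.
pose phi := fwd c0 \o bwd c.
have phiq : phi (fwd c q) = fwd c0 q by rewrite /phi /= fwdK.
have oA : open (fwd c @` (dom c `&` dom c0)).
  by rewrite setIC; apply: imageI_open; exact: dom_open.
have Aq : (fwd c @` (dom c `&` dom c0)) (fwd c q) by exists q.
have dphi : derivable phi (fwd c q) (e_ j).
  apply/derivable_mxP => i k; rewrite ord1.
  exact: (@smooth_derivable _ _ _ _ _ _ oA Aq (atlas_compatible ac ac0 k)).
have [_ E] : is_derive (fwd c q) (e_ j) ((f \o bwd c0) \o phi)
    (\sum_i 'D_(e_ j) (fun y => phi y 0 i) (fwd c q) *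
            partial i (f \o bwd c0) (phi (fwd c q))).
  by apply: is_derive_comp; rewrite ?phiq.
transitivity ('D_(e_ j) ((f \o bwd c0) \o phi) (fwd c q)); last first.
  apply: near_eq_derive; apply: near_open oA Aq _ => _ [q' [dq' d0q'] <-].
  by rewrite /phi /= !fwdK.
rewrite E phiq /pairing mxE; apply: eq_bigr => i _.
rewrite !mxE; congr (_ * _).
by rewrite /coord_field derive_mx // mxE.
Qed.

End charts.

(** * Components of tensor fields *)

Section components.
Context {R : realType} {n : nat} {M : smooth_manifold R n}.
Implicit Types (U V W Z : set M) (f h : M -> R) (c : chart R n M).
Implicit Types (X Y : vector_field M) (a b : one_form M) (P g : bilinear_field M).

Notation e_ i := (delta_mx 0 i : 'rV[R]_n).

Definition frame c (q : M) : 'M[R]_n := \matrix_i coord_field c i q.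
Definition coframe c (q : M) : 'M[R]_n := \matrix_i diff (coord c i) q.

(** Components are kept together as matrices: pairings, contractions and changes
    of charts become products, and so do the coordinate expressions of the Lie
    derivatives. *)
Definition vcomp c X q : 'rV[R]_n := X q *m (coframe c q)^T.
Definition fcomp c a q : 'rV[R]_n := a q *m (frame c q)^T.
Definition bcomp c P q : 'M[R]_n := coframe c q *m P q *m (coframe c q)^T.

Lemma vcompE c X q j : vcomp c X q 0 j = act X (coord c j) q.
Proof.
by rewrite /act /pairing !mxE; apply: eq_bigr => k _; rewrite !mxE.
Qed.

Lemma fcompE c a q j : fcomp c a q 0 j = pairing (a q) (coord_field c j q).
Proof.
by rewrite /pairing !mxE; apply: eq_bigr => k _; rewrite !mxE mulrC.
Qed.

Lemma bcompE c P q i j :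
  bcomp c P q i j = bilin (P q) (diff (coord c i) q) (diff (coord c j) q).
Proof. by rewrite /bcomp bilin_rows !rowK. Qed.

(** The coordinate fields and differentials of a chart are dual bases; as both
    are expressed in the preferred chart at [q], this is an instance of the chain
    rule. *)
Lemma coframe_frame c q : atlas c -> dom c q ->
  coframe c q *m (frame c q)^T = 1%:M.
Proof.
move=> ac dq; apply/matrixP => i j.
transitivity (pairing (diff (coord c i) q) (coord_field c j q)).
  by rewrite /pairing !mxE; apply: eq_bigr => k _; rewrite !mxE mulrC.
have sc : smooth_function (dom c) (coord c i) by exact: smooth_coord_function.
rewrite (diff_coord_field j ac (dom_open c) dq dq sc) mxE.
transitivity ('D_(e_ j) (fun y : 'rV[R]_n => y 0 i) (fwd c q)).
  have cq : (fwd c @` dom c) (fwd c q) by exists q.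
  rewrite /partial; apply: near_eq_derive.
  apply: near_open (@cod_open _ _ _ c) cq _ => _ [q' dq' <-].
  by rewrite /coord /= fwdK.
by have [_ ->] := is_derive_coord (fwd c q) (e_ j) i; rewrite mxE eqxx.
Qed.

Lemma frame_coframe c q : atlas c -> dom c q ->
  (frame c q)^T *m coframe c q = 1%:M.
Proof. by move=> ac dq; apply: mulmx1C; exact: coframe_frame. Qed.

Lemma frame_coframeT c q : atlas c -> dom c q ->
  (coframe c q)^T *m frame c q = 1%:M.
Proof.
by move=> ac dq; apply: trmx_inj; rewrite trmx_mul trmxK trmx1 frame_coframe.
Qed.

Lemma coframeT_frame c q : atlas c -> dom c q ->
  frame c q *m (coframe c q)^T = 1%:M.
Proof. by move=> ac dq; apply: mulmx1C; exact: frame_coframeT. Qed.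

Section in_chart.
Variables (c : chart R n M) (q : M).
Hypotheses (ac : atlas c) (dq : dom c q).

Lemma pairing_comp a X :
  pairing (a q) (X q) = (vcomp c X q *m (fcomp c a q)^T) 0 0.
Proof.
rewrite /pairing /vcomp /fcomp trmx_mul trmxK -mulmxA [in RHS](mulmxA _^T).
by rewrite frame_coframeT // mul1mx.
Qed.

Lemma bilin_comp P a b : bilin (P q) (a q) (b q) =
  (fcomp c a q *m bcomp c P q *m (fcomp c b q)^T) 0 0.
Proof.
rewrite /bilin /fcomp /bcomp trmx_mul trmxK !mulmxA.
rewrite -[a q *m _ *m coframe c q]mulmxA frame_coframe // mulmx1.
by rewrite -[a q *m P q *m _ *m frame c q]mulmxA frame_coframeT // mulmx1.
Qed.

Lemma vcomp_sharp P a : vcomp c (sharp P a) q = fcomp c a q *m bcomp c P q.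
Proof.
rewrite /vcomp /sharp /anchor /fcomp /bcomp !mulmxA.
by rewrite -[a q *m _ *m coframe c q]mulmxA frame_coframe // mulmx1.
Qed.

Lemma fcomp_flat g X : fcomp c (fun q => X q *m g q) q =
  vcomp c X q *m (frame c q *m g q *m (frame c q)^T).
Proof.
by rewrite /vcomp /fcomp !mulmxA -[X q *m _ *m frame c q]mulmxA frame_coframeT // mulmx1.
Qed.

Lemma bilin_vcomp g X Y : bilin (g q) (X q) (Y q) =
  (vcomp c X q *m (frame c q *m g q *m (frame c q)^T) *m (vcomp c Y q)^T) 0 0.
Proof.
rewrite /bilin /vcomp trmx_mul trmxK !mulmxA.
rewrite -[X q *m _ *m frame c q]mulmxA frame_coframeT // mulmx1.
by rewrite -[X q *m g q *m _ *m coframe c q]mulmxA frame_coframe // mulmx1.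
Qed.

Lemma rank_bcomp P : \rank (bcomp c P q) = \rank (P q).
Proof.
have uC : coframe c q \in unitmx by have [] := mulmx1_unit (coframe_frame ac dq).
rewrite /bcomp mxrankMfree ?row_free_unit ?unitmx_tr //.
by rewrite -mxrank_tr trmx_mul mxrankMfree ?mxrank_tr // row_free_unit unitmx_tr.
Qed.

Lemma fcomp_of_components (F : M -> 'rV[R]_n) :
  fcomp c (fun q => F q *m coframe c q) q = F q.
Proof. by rewrite /fcomp -mulmxA coframe_frame // mulmx1. Qed.

End in_chart.

Lemma frame_chart_at p : frame (chart_at p) p = 1%:M.
Proof.
apply/matrixP => i j; rewrite !mxE /coord_field.
have dp := @chart_at_dom _ _ _ p.
have cp : (fwd (chart_at p) @` dom (chart_at p)) (fwd (chart_at p) p) by exists p.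
have -> : 'D_(e_ i) (fwd (chart_at p) \o bwd (chart_at p)) (fwd (chart_at p) p) =
    'D_(e_ i) (fun y : 'rV[R]_n => y) (fwd (chart_at p) p).
  apply: near_eq_derive.
  by apply: near_open (@cod_open _ _ _ _) cp _ => _ [q dq <-] /=; rewrite fwdK.
by rewrite derive_id mxE eqxx /= eq_sym.
Qed.

Lemma coframe_chart_at p : coframe (chart_at p) p = 1%:M.
Proof.
have := coframe_frame (@chart_at_atlas _ _ _ p) (@chart_at_dom _ _ _ p).
by rewrite frame_chart_at trmx1 mulmx1.
Qed.

Lemma vcomp_chart_at p X : vcomp (chart_at p) X p = X p.
Proof. by rewrite /vcomp coframe_chart_at trmx1 mulmx1. Qed.

Lemma fcomp_chart_at p a : fcomp (chart_at p) a p = a p.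
Proof. by rewrite /fcomp frame_chart_at trmx1 mulmx1. Qed.

Lemma bcomp_chart_at p P : bcomp (chart_at p) P p = P p.
Proof. by rewrite /bcomp coframe_chart_at trmx1 mulmx1 mul1mx. Qed.

(** * Smooth tensor fields *)

Definition smooth_mx V k l (F : M -> 'M[R]_(k, l)) : Prop :=
  forall i j, smooth_function V (fun q => F q i j).

Lemma smooth_mxM V k l m (F : M -> 'M[R]_(k, l)) (G : M -> 'M[R]_(l, m)) : open V ->
  smooth_mx V F -> smooth_mx V G -> smooth_mx V (fun q => F q *m G q).
Proof.
move=> oV sF sG i j.
apply: (@eq_smooth_function _ _ _ _ (fun q => \sum_k F q i k * G q k j)) => //.
  by move=> q _; rewrite mxE.
by apply: smooth_function_sum => // k'; apply: smooth_functionM oV (sF i k') (sG k' j).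
Qed.

Lemma smooth_mx_tr V k l (F : M -> 'M[R]_(k, l)) : open V ->
  smooth_mx V F -> smooth_mx V (fun q => (F q)^T).
Proof.
move=> oV sF i j; apply: (@eq_smooth_function _ _ _ _ (fun q => F q j i)) => //.
by move=> q _; rewrite mxE.
Qed.

Lemma smooth_mx_sub U V k l (F : M -> 'M[R]_(k, l)) : V `<=` U ->
  smooth_mx U F -> smooth_mx V F.
Proof. by move=> VU sF i j; apply: smooth_function_sub VU (sF i j). Qed.

Lemma eq_smooth_mx V k l (F G : M -> 'M[R]_(k, l)) : open V ->
  (forall q, V q -> F q = G q) -> smooth_mx V F -> smooth_mx V G.
Proof.
move=> oV FG sF i j; apply: (@eq_smooth_function _ _ _ _ (fun q => F q i j)) => //.
by move=> q Vq; rewrite FG.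
Qed.

Lemma smooth_mx_cst V k l (A : 'M[R]_(k, l)) : smooth_mx V (fun=> A).
Proof. by move=> i j; exact: smooth_function_cst. Qed.

Lemma smooth_vcomp U X : open U -> smooth_vector_field U X <->
  forall c, atlas c -> smooth_mx (U `&` dom c) (vcomp c X).
Proof.
move=> oU; split=> sX c ac i => [j|].
  apply: eq_smooth_function (openI_dom _ oU) _ (sX c ac j) => q _.
  by rewrite ord1 vcompE.
apply: eq_smooth_function (openI_dom _ oU) _ (sX c ac 0 i) => q _.
by rewrite vcompE.
Qed.

Lemma smooth_fcomp U a : open U -> smooth_one_form U a <->
  forall c, atlas c -> smooth_mx (U `&` dom c) (fcomp c a).
Proof.
move=> oU; split=> sX c ac i => [j|].
  apply: eq_smooth_function (openI_dom _ oU) _ (sX c ac j) => q _.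
  by rewrite ord1 fcompE.
apply: eq_smooth_function (openI_dom _ oU) _ (sX c ac 0 i) => q _.
by rewrite fcompE.
Qed.

Lemma smooth_bcomp P c : smooth_bivector_field P -> atlas c ->
  smooth_mx (dom c) (bcomp c P).
Proof.
move=> [_ sP] ac i j; apply: eq_smooth_function (dom_open c) _ (sP c ac i j) => q _.
by rewrite bcompE.
Qed.

Lemma smooth_gcomp g c : riemannian_metric g -> atlas c ->
  smooth_mx (dom c) (fun q => frame c q *m g q *m (frame c q)^T).
Proof.
move=> [_ _ sg] ac i j; apply: eq_smooth_function (dom_open c) _ (sg c ac i j) => q _.
by rewrite bilin_rows !rowK.
Qed.

Lemma smooth_change c c' : atlas c -> atlas c' ->
  smooth_mx (dom c `&` dom c') (fun q => coframe c q *m (frame c' q)^T).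
Proof.
move=> ac ac' i j.
have oV : open (dom c `&` dom c') by apply: openI_dom; exact: dom_open.
have sc : smooth_function (dom c `&` dom c') (coord c i).
  apply: smooth_function_sub (smooth_coord_function i ac); exact: subIsetl.
have sp := smooth_function_partial j ac' oV (@subIsetr _ _ _) sc.
apply: eq_smooth_function sp => // q [dq dq'].
rewrite -(diff_coord_field j ac' oV (conj dq dq') dq' sc).
by rewrite /pairing !mxE; apply: eq_bigr => k _; rewrite !mxE mulrC.
Qed.

(** In another chart the components are multiplied by the matrix of the change of
    charts, which is smooth. *)
Lemma smooth_one_form_chart c V a : atlas c -> open V -> V `<=` dom c ->
  smooth_mx V (fcomp c a) -> smooth_one_form V a.
Proof.
move=> ac oV Vd sa; apply/(smooth_fcomp _ oV) => c' ac'.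
have oV' : open (V `&` dom c') := openI_dom _ oV.
apply: (@eq_smooth_mx _ _ _
  (fun q => fcomp c a q *m (coframe c q *m (frame c' q)^T))) => //.
  move=> q [Vq dq']; rewrite /fcomp mulmxA -(mulmxA (a q)) frame_coframe //.
    by rewrite mulmx1.
  exact: Vd.
apply: smooth_mxM => //; first by apply: smooth_mx_sub sa; exact: subIsetl.
by apply: smooth_mx_sub (smooth_change ac ac'); exact: setSI.
Qed.

Lemma smooth_sharp U P a : open U -> smooth_bivector_field P ->
  smooth_one_form U a -> smooth_vector_field U (sharp P a).
Proof.
move=> oU sP /(smooth_fcomp _ oU) sa; apply/(smooth_vcomp _ oU) => c ac.
have oV : open (U `&` dom c) := openI_dom _ oU.
apply: (@eq_smooth_mx _ _ _ (fun q => fcomp c a q *m bcomp c P q)) => //.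
  by move=> q [_ dq]; rewrite vcomp_sharp.
apply: smooth_mxM => //; first exact: sa.
by apply: smooth_mx_sub (smooth_bcomp sP ac); exact: subIsetr.
Qed.

Lemma smooth_flat_form U g X : open U -> riemannian_metric g ->
  smooth_vector_field U X -> smooth_one_form U (fun q => X q *m g q).
Proof.
move=> oU rg /(smooth_vcomp _ oU) sX; apply/(smooth_fcomp _ oU) => c ac.
have oV : open (U `&` dom c) := openI_dom _ oU.
apply: (@eq_smooth_mx _ _ _ (fun q => vcomp c X q *m
  (frame c q *m g q *m (frame c q)^T))) => //.
  by move=> q [_ dq]; rewrite fcomp_flat.
apply: smooth_mxM => //; first exact: sX.
by apply: smooth_mx_sub (smooth_gcomp rg ac); exact: subIsetr.
Qed.

Lemma smooth_metric U g X Y : open U -> riemannian_metric g ->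
  smooth_vector_field U X -> smooth_vector_field U Y ->
  smooth_function U (fun q => bilin (g q) (X q) (Y q)).
Proof.
move=> oU rg /(smooth_vcomp _ oU) sX /(smooth_vcomp _ oU) sY.
apply: smooth_function_local => c ac.
have oV : open (U `&` dom c) := openI_dom _ oU.
apply: (@eq_smooth_function _ _ _ _ (fun q => (vcomp c X q *m
  (frame c q *m g q *m (frame c q)^T) *m (vcomp c Y q)^T) 0 0)) => //.
  by move=> q [_ dq]; rewrite (bilin_vcomp ac).
have : smooth_mx (U `&` dom c) (fun q => (vcomp c X q *m
  (frame c q *m g q *m (frame c q)^T) *m (vcomp c Y q)^T)).
  apply: smooth_mxM => //; last by apply: smooth_mx_tr => //; exact: sY.
  apply: smooth_mxM => //; first exact: sX.
  by apply: smooth_mx_sub (smooth_gcomp rg ac); exact: subIsetr.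
by apply.
Qed.

End components.

(** * Derivatives at a point *)

Section derivatives.
Context {R : realType} {n : nat} {M : smooth_manifold R n}.
Variable p : M.
Local Notation c := (chart_at p).
Local Notation x0 := (fwd (chart_at p) p).
Implicit Types (f h : M -> R).
Implicit Types (X Y : vector_field M) (a b : one_form M) (P g : bilinear_field M).

Notation e_ i := (delta_mx 0 i : 'rV[R]_n).

Definition derivable_at f : Prop := forall l, derivable (f \o bwd c) x0 (e_ l).

Lemma smooth_derivable_at V f : open V -> V p -> smooth_function V f ->
  derivable_at f.
Proof.
move=> oV Vp sf l; apply: diff_derivable.
exact: (smooth_function_differentiable (@chart_at_atlas _ _ _ p) oV Vp
  (@chart_at_dom _ _ _ p) sf).
Qed.

Lemma near_chart (Q : M -> Prop) : (\forall q \near p, Q q) ->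
  \forall x \near x0, Q (bwd c x).
Proof.
move=> nQ; have cp : (fwd c @` dom c) x0 by exists p => //; exact: chart_at_dom.
by apply: (bwd_continuous cp); rewrite fwdK //; exact: chart_at_dom.
Qed.

Lemma near_eq_diff f h : (\forall q \near p, f q = h q) -> diff f p = diff h p.
Proof.
move=> fh; apply/rowP => l; rewrite !mxE; apply: near_eq_derive.
exact: near_chart fh.
Qed.

Lemma diff_cst_at (k : R) : diff (fun=> k) p = 0.
Proof. by apply/rowP => l; rewrite !mxE [LHS]derive_cst. Qed.

Lemma derivable_at_cst (k : R) : derivable_at (fun=> k).
Proof. by move=> l; exact: derivable_cst. Qed.

Lemma bwd_fwd_chart_at : bwd c x0 = p.
Proof. by rewrite fwdK //; exact: chart_at_dom. Qed.

Lemma derivable_atD f h : derivable_at f -> derivable_at h ->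
  derivable_at (fun q => f q + h q).
Proof. by move=> df dh l; apply: derivableD (df l) (dh l). Qed.

Lemma diffD f h : derivable_at f -> derivable_at h ->
  diff (fun q => f q + h q) p = diff f p + diff h p.
Proof. by move=> df dh; apply/rowP => l; rewrite !mxE -(deriveD (df l) (dh l)). Qed.

Lemma derivable_atM f h : derivable_at f -> derivable_at h ->
  derivable_at (fun q => f q * h q).
Proof. by move=> df dh l; apply: derivableM (df l) (dh l). Qed.

Lemma diffM f h : derivable_at f -> derivable_at h ->
  diff (fun q => f q * h q) p = f p *: diff h p + h p *: diff f p.
Proof.
move=> df dh; apply/rowP => l; rewrite !mxE.
by have := deriveM (df l) (dh l); rewrite /= bwd_fwd_chart_at => <-.
Qed.

Lemma derivable_at_sum (I : Type) (r : seq I) (F : I -> M -> R) :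
  (forall i, derivable_at (F i)) -> derivable_at (fun q => \sum_(i <- r) F i q).
Proof.
move=> dF; elim: r => [|i r IH].
  rewrite (_ : (fun=> _) = fun=> 0); first exact: derivable_at_cst.
  by apply/funext => q; rewrite big_nil.
rewrite (_ : (fun=> _) = fun q => F i q + \sum_(j <- r) F j q).
  exact: (derivable_atD (dF i) IH).
by apply/funext => q; rewrite big_cons.
Qed.

Lemma diff_sum (I : Type) (r : seq I) (F : I -> M -> R) :
  (forall i, derivable_at (F i)) ->
  diff (fun q => \sum_(i <- r) F i q) p = \sum_(i <- r) diff (F i) p.
Proof.
move=> dF; elim: r => [|i r IH].
  rewrite big_nil -(diff_cst_at 0); congr (diff _ p).
  by apply/funext => q; rewrite big_nil.
rewrite big_cons -IH -diffD //; last exact: derivable_at_sum.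
by congr (diff _ p); apply/funext => q; rewrite big_cons.
Qed.

Definition derive_at k l (v : 'rV[R]_n) (F : M -> 'M[R]_(k, l)) : 'M[R]_(k, l) :=
  \matrix_(i, j) pairing (diff (fun q => F q i j) p) v.

Definition derivable_mx k l (F : M -> 'M[R]_(k, l)) : Prop :=
  forall i j, derivable_at (fun q => F q i j).

Lemma smooth_derivable_mx V k l (F : M -> 'M[R]_(k, l)) : open V -> V p ->
  smooth_mx V F -> derivable_mx F.
Proof. by move=> oV Vp sF i j; exact: smooth_derivable_at oV Vp (sF i j). Qed.

Lemma derive_atM k l m v (F : M -> 'M[R]_(k, l)) (G : M -> 'M[R]_(l, m)) :
  derivable_mx F -> derivable_mx G ->
  derive_at v (fun q => F q *m G q) = derive_at v F *m G p + F p *m derive_at v G.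
Proof.
move=> dF dG; apply/matrixP => i j; rewrite mxE.
rewrite (_ : (fun q => _) = fun q => \sum_k' F q i k' * G q k' j); last first.
  by apply/funext => q; rewrite mxE.
rewrite diff_sum; last by move=> k'; apply: derivable_atM (dF i k') (dG k' j).
rewrite pairing_suml !mxE -big_split; apply: eq_bigr => k' _.
rewrite (diffM (dF i k') (dG k' j)) pairingDl !pairingZl !mxE.
by rewrite addrC [_ * G p k' j]mulrC.
Qed.

Lemma derivable_mxM k l m (F : M -> 'M[R]_(k, l)) (G : M -> 'M[R]_(l, m)) :
  derivable_mx F -> derivable_mx G -> derivable_mx (fun q => F q *m G q).
Proof.
move=> dF dG i j.
rewrite (_ : (fun q => _) = fun q => \sum_k' F q i k' * G q k' j); last first.
  by apply/funext => q; rewrite mxE.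
by apply: derivable_at_sum => k'; apply: derivable_atM (dF i k') (dG k' j).
Qed.

Lemma derive_at_tr k l v (F : M -> 'M[R]_(k, l)) :
  derive_at v (fun q => (F q)^T) = (derive_at v F)^T.
Proof.
apply/matrixP => i j; rewrite !mxE; congr (pairing (diff _ p) v).
by apply/funext => q; rewrite mxE.
Qed.

Lemma derivable_mx_tr k l (F : M -> 'M[R]_(k, l)) :
  derivable_mx F -> derivable_mx (fun q => (F q)^T).
Proof.
move=> dF i j; rewrite (_ : (fun q => _) = fun q => F q j i) //.
by apply/funext => q; rewrite mxE.
Qed.

Lemma near_eq_derive_at k l v (F G : M -> 'M[R]_(k, l)) :
  (\forall q \near p, F q = G q) -> derive_at v F = derive_at v G.
Proof.
move=> FG; apply/matrixP => i j; rewrite !mxE; congr (pairing _ v).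
by apply: near_eq_diff; apply: filterS FG => q ->.
Qed.

Lemma derive_at_cst k l v (A : 'M[R]_(k, l)) : derive_at v (fun=> A) = 0.
Proof. by apply/matrixP => i j; rewrite !mxE diff_cst_at pairing0l. Qed.

Lemma derive_atZ k l v f (F : M -> 'M[R]_(k, l)) : derivable_at f -> derivable_mx F ->
  derive_at v (fun q => f q *: F q) = pairing (diff f p) v *: F p + f p *: derive_at v F.
Proof.
move=> df dF; apply/matrixP => i j; rewrite !mxE.
rewrite (_ : (fun q => _) = fun q => f q * F q i j); last first.
  by apply/funext => q; rewrite mxE.
by rewrite (diffM df (dF i j)) pairingDl !pairingZl addrC [F p i j * _]mulrC.
Qed.

(** * Coordinate expressions of the Lie derivatives *)

(** The transpose of the usual Jacobian matrix: vectors are rows, and act on it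
    from the left as directions of derivation. *)
Definition jac X : 'M[R]_n := \matrix_(l, i) diff (fun q => vcomp c X q 0 i) p 0 l.

Lemma derive_at_vcomp v X : derive_at v (vcomp c X) = v *m jac X.
Proof.
apply/rowP => i; rewrite !mxE /pairing mxE; apply: eq_bigr => l _.
by rewrite !mxE.
Qed.

Let ac : atlas c := @chart_at_atlas _ _ _ p.
Let dp : dom c p := @chart_at_dom _ _ _ p.

Lemma near_dom (Q : M -> Prop) : (forall q, dom c q -> Q q) ->
  \forall q \near p, Q q.
Proof.
move=> H; have : nbhs p (dom c) by apply: open_nbhs_nbhs; split => //; exact: dom_open.
exact: filterS.
Qed.

Lemma lie_bracketE X Y :
  lie_bracket X Y p = X p *m jac Y - Y p *m jac X.
Proof.
rewrite -!derive_at_vcomp; apply/rowP => j; rewrite !mxE.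
have E Z : act Z (coord c j) = (fun q => vcomp c Z q 0 j).
  by apply/funext => q; rewrite vcompE.
by rewrite !E /act.
Qed.

Lemma coord_field_chart_at j : coord_field c j p = e_ j.
Proof.
have := congr1 (row j) (frame_chart_at p).
by rewrite rowK => ->; rewrite row1.
Qed.

Lemma diff_coord_chart_at j : diff (coord c j) p = e_ j.
Proof.
have := congr1 (row j) (coframe_chart_at p).
by rewrite rowK => ->; rewrite row1.
Qed.

Lemma vcomp_coord_field j q : dom c q -> vcomp c (coord_field c j) q = e_ j.
Proof.
move=> dq; have := congr1 (row j) (coframeT_frame ac dq).
by rewrite row_mul rowK row1.
Qed.

Lemma fcomp_diff_coord j q : dom c q -> fcomp c (diff (coord c j)) q = e_ j.
Proof.
move=> dq; have := congr1 (row j) (coframe_frame ac dq).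
by rewrite row_mul rowK row1.
Qed.

Lemma lie_one_formE X a :
  lie_one_form X a p = derive_at (X p) (fcomp c a) + a p *m (jac X)^T.
Proof.
apply/rowP => j; rewrite !mxE /= /act.
rewrite (_ : (fun q => pairing (a q) _) = (fun q => fcomp c a q 0 j)); last first.
  by apply/funext => q; rewrite fcompE.
congr (_ + _).
rewrite lie_bracketE coord_field_chart_at -derive_at_vcomp.
rewrite (near_eq_derive_at _ (G := fun=> e_ j)); last first.
  by apply: near_dom => q; exact: vcomp_coord_field.
rewrite derive_at_cst sub0r /pairing mulNmx mxE opprK.
rewrite -rowE mxE; apply: eq_bigr => k _.
by rewrite !mxE mulrC.
Qed.

Lemma lie_bivectorE X P : lie_bivector X P p =
  derive_at (X p) (bcomp c P) - (jac X)^T *m P p - P p *m jac X.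
Proof.
have L i : lie_one_form X (diff (coord c i)) p = row i (jac X)^T.
  rewrite lie_one_formE (near_eq_derive_at _ (G := fun=> e_ i)); last first.
    by apply: near_dom => q; exact: fcomp_diff_coord.
  by rewrite derive_at_cst add0r diff_coord_chart_at -rowE.
have d i : diff (coord c i) p = row i 1%:M by rewrite diff_coord_chart_at row1.
apply/matrixP => i j.
have E (A B C : 'M[R]_n) : (A - B - C) i j = A i j - B i j - C i j by rewrite !mxE.
rewrite [LHS]mxE E [derive_at _ _ i j]mxE; cbv zeta.
rewrite !L !d -!bilin_rows trmx1 trmxK mulmx1 mul1mx /act.
rewrite (_ : (fun q => bilin _ _ _) = fun q => bcomp c P q i j) //.
by apply/funext => q; rewrite bcompE.
Qed.

End derivatives.

(** * Identities of the tensor calculus *)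

Section identities.
Context {R : realType} {n : nat} {M : smooth_manifold R n}.
Variable p : M.
Local Notation c := (chart_at p).
Implicit Types (f h : M -> R).
Implicit Types (X Y : vector_field M) (a b : one_form M) (P g : bilinear_field M).

Notation e_ i := (delta_mx 0 i : 'rV[R]_n).

Let ac : atlas c := @chart_at_atlas _ _ _ p.

Lemma act_derive_at X f (F : M -> 'M[R]_1) :
  (forall q, dom c q -> f q = F q 0 0) -> act X f p = derive_at p (X p) F 0 0.
Proof.
by move=> fF; rewrite /act mxE (near_eq_diff (near_dom fF)).
Qed.

(** The derivatives of [X] enter [L_X a] and the bracket with opposite signs; the
    rest is the Leibniz rule. *)
Lemma lie_pairing X a Y :
  derivable_mx p (fcomp c a) -> derivable_mx p (vcomp c Y) ->
  act X (fun q => pairing (a q) (Y q)) p =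
  pairing (lie_one_form X a p) (Y p) + pairing (a p) (lie_bracket X Y p).
Proof.
move=> da dY.
rewrite (@act_derive_at _ _ (fun q => vcomp c Y q *m (fcomp c a q)^T)); last first.
  by move=> q dq; rewrite -pairing_comp.
rewrite derive_atM //; last exact: derivable_mx_tr.
rewrite derive_at_tr derive_at_vcomp vcomp_chart_at fcomp_chart_at.
rewrite /pairing addmx00 lie_one_formE lie_bracketE; congr (fun_of_matrix _ 0 0).
rewrite linearD /= trmx_mul trmxK mulmxDr mulmxBl !mulmxA.
by rewrite addrC addrA -!addrA; congr (_ + _); rewrite addrCA subrr addr0.
Qed.

Lemma lie_bilin X P a b : derivable_mx p (bcomp c P) ->
  derivable_mx p (fcomp c a) -> derivable_mx p (fcomp c b) ->
  act X (fun q => bilin (P q) (a q) (b q)) p =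
  bilin (lie_bivector X P p) (a p) (b p)
  + bilin (P p) (lie_one_form X a p) (b p)
  + bilin (P p) (a p) (lie_one_form X b p).
Proof.
move=> dP da db.
rewrite (@act_derive_at _ _
  (fun q => fcomp c a q *m bcomp c P q *m (fcomp c b q)^T)); last first.
  by move=> q dq; rewrite -bilin_comp.
rewrite derive_atM; [|exact: derivable_mxM|exact: derivable_mx_tr].
rewrite derive_atM // derive_at_tr bcomp_chart_at !fcomp_chart_at.
rewrite /bilin !addmx00 !lie_one_formE lie_bivectorE; congr (fun_of_matrix _ 0 0).
set Da := derive_at _ _ (fcomp c a); set Db := derive_at _ _ (fcomp c b).
rewrite [(Db + _)^T]linearD /= trmx_mul trmxK.
rewrite !(mulmxDr, mulmxDl, mulmxN, mulNmx, mulmxA).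
set t1 := Da *m _ *m _; set t2 := _ *m Db^T; set t3 := a p *m derive_at _ _ _ *m _.
set t4 := _ *m (jac p X)^T *m _ *m _; set t5 := _ *m jac p X *m _.
move: t1 t2 t3 t4 t5 => t1 t2 t3 t4 t5.
by apply/matrixP => i j; rewrite !mxE; ring.
Qed.

(** Brackets with the fields [P b] detect [L_X P]: this is the link between
    foliated fields and Poisson fields. *)
Lemma lie_sharp X P b : derivable_mx p (bcomp c P) -> derivable_mx p (fcomp c b) ->
  lie_bracket X (sharp P b) p =
  lie_one_form X b p *m P p + b p *m lie_bivector X P p.
Proof.
move=> dP db; rewrite lie_bracketE -derive_at_vcomp.
rewrite (@near_eq_derive_at _ _ _ p _ _ _ _
  (fun q => fcomp c b q *m bcomp c P q)); last first.
  by apply: near_dom => q dq; rewrite vcomp_sharp.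
rewrite derive_atM // bcomp_chart_at fcomp_chart_at lie_one_formE lie_bivectorE.
rewrite /sharp /anchor !(mulmxDr, mulmxDl, mulmxN, mulmxA).
set t1 := derive_at _ _ (fcomp c b) *m P p; set t2 := b p *m derive_at _ _ _.
set t3 := b p *m P p *m jac p X; set t4 := b p *m _^T *m P p; move: t1 t2 t3 t4 => t1 t2 t3 t4.
by apply/matrixP => i j; rewrite !mxE; ring.
Qed.

Section antisymmetric.
Variable P : bilinear_field M.
Hypothesis antiP : forall q, (P q)^T = - P q.

Lemma bcomp_antisym q : (bcomp c P q)^T = - bcomp c P q.
Proof. by rewrite /bcomp !trmx_mul trmxK antiP mulNmx mulmxN mulmxA. Qed.

Lemma derive_atN k l v (F : M -> 'M[R]_(k, l)) : derivable_mx p F ->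
  derive_at p v (fun q => - F q) = - derive_at p v F.
Proof.
move=> dF; rewrite (_ : (fun q => _) = fun q => -1 *: F q); last first.
  by apply/funext => q; rewrite scaleN1r.
rewrite (derive_atZ _ (derivable_at_cst (p := p) (k := -1)) dF).
by rewrite diff_cst_at pairing0l scale0r add0r scaleN1r.
Qed.

Hypothesis dP : derivable_mx p (bcomp c P).

Lemma lie_bivector_antisym X : (lie_bivector X P p)^T = - lie_bivector X P p.
Proof.
rewrite lie_bivectorE !linearB /= -derive_at_tr !trmx_mul trmxK antiP.
rewrite (_ : (fun q => (bcomp c P q)^T) = fun q => - bcomp c P q); last first.
  by apply/funext => q; exact: bcomp_antisym.
rewrite derive_atN // mulNmx mulmxN.
set t1 := derive_at _ _ _; set t2 := _ *m jac p X; set t3 := _ *m P p.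
move: t1 t2 t3 => t1 t2 t3.
by apply/matrixP => i j; rewrite !mxE; ring.
Qed.

(** The Koszul bracket is the antisymmetrization of a torsion-free connection, so
    that this formula expresses [L_X P] by means of the connection. *)
Lemma lie_bivector_koszul X a b :
  derivable_mx p (vcomp c X) -> derivable_mx p (fcomp c a) ->
  derivable_mx p (fcomp c b) ->
  bilin (lie_bivector X P p) (a p) (b p) =
  pairing (koszul_bracket P a b p) (X p)
  - act (sharp P a) (fun q => pairing (b q) (X q)) p
  + act (sharp P b) (fun q => pairing (a q) (X q)) p.
Proof.
move=> dX da db.
have pDr (u v w : 'rV[R]_n) : pairing w (u + v) = pairing w u + pairing w v.
  by rewrite /pairing mulmxDl mxE.
have bracketC Y Z : lie_bracket Y Z p = - lie_bracket Z Y p.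
  by rewrite !lie_bracketE opprB.
have pN (u w : 'rV[R]_n) : pairing w (- u) = - pairing w u.
  by rewrite /pairing mulNmx mxE.
have bil (A : 'M[R]_n) u v : pairing v (u *m A) = bilin A u v by [].
rewrite /koszul_bracket !pairingBl !lie_pairing // !(bracketC (sharp _ _) X) !lie_sharp //.
rewrite !pN !pDr !bil.
have := lie_bilin X dP da db; rewrite /act => ->.
rewrite (bilin_antisym (lie_one_form X b p) (a p) (antiP p)).
rewrite (bilin_antisym (b p) (a p) (lie_bivector_antisym X)).
set t1 := bilin (lie_bivector X P p) _ _; set t2 := pairing _ _; set t3 := pairing _ _.
set t4 := bilin _ _ _; set t5 := bilin _ _ _.
by move: t1 t2 t3 t4 t5 => t1 t2 t3 t4 t5; ring.
Qed.

Lemma bilin_derive_at_bcomp (u v w : 'rV[R]_n) :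
  bilin (derive_at p (w *m P p) (bcomp c P)) u v =
  \sum_i \sum_j \sum_k u 0 i * v 0 j * w 0 k * derive_at p (row k (P p)) (bcomp c P) i j.
Proof.
rewrite /bilin mxE [RHS]exchange_big /=; apply: eq_bigr => j _.
rewrite [v^T _ _]mxE mxE mulr_suml; apply: eq_bigr => i _.
have -> : derive_at p (w *m P p) (bcomp c P) i j =
    \sum_k w 0 k * derive_at p (row k (P p)) (bcomp c P) i j.
  rewrite mxE /pairing -mulmxA mxE; apply: eq_bigr => k _.
  by rewrite [in RHS]mxE /pairing -row_mul [row _ _ _ _]mxE.
by rewrite mulr_sumr mulr_suml; apply: eq_bigr => k _; ring.
Qed.

(** The vanishing of [P, P] is given on coordinate differentials, and extends by
    trilinearity in the values of the covectors. *)
Lemma jacobi_trilinear (u v w : 'rV[R]_n) : poisson_tensor P ->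
  bilin (derive_at p (w *m P p) (bcomp c P)) u v
  + bilin (derive_at p (u *m P p) (bcomp c P)) v w
  + bilin (derive_at p (v *m P p) (bcomp c P)) w u = 0.
Proof.
move=> [_ jP]; rewrite !bilin_derive_at_bcomp.
pose T i j k := derive_at p (row k (P p)) (bcomp c P) i j.
have bdE i j : biderivation P (coord c i) (coord c j) = fun q => bcomp c P q i j.
  by apply/funext => q; rewrite bcompE.
have bdT i j k : biderivation P (biderivation P (coord c i) (coord c j)) (coord c k) p
    = - T i j k.
  rewrite /biderivation bilin_antisym // -[fun q => _]/(biderivation P _ _) bdE.
  by rewrite diff_coord_chart_at /T mxE rowE.
have T0 i j k : T i j k + T j k i + T k i j = 0.
  have := jP p i j k; rewrite /schouten !bdT => H.
  have : - 2 * (T i j k + T j k i + T k i j) = 0 by rewrite -[RHS]H; ring.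
  by move/eqP; rewrite mulf_eq0 oppr_eq0 pnatr_eq0 /= => /eqP.
have E2 : \sum_i \sum_j \sum_k v 0 i * w 0 j * u 0 k * T i j k =
    \sum_i \sum_j \sum_k u 0 i * v 0 j * w 0 k * T j k i.
  transitivity (\sum_i \sum_k \sum_j v 0 i * w 0 j * u 0 k * T i j k).
    by apply: eq_bigr => i _; rewrite exchange_big.
  rewrite exchange_big /=; apply: eq_bigr => k _; apply: eq_bigr => i _.
  by apply: eq_bigr => j _; ring.
have E3 : \sum_i \sum_j \sum_k w 0 i * u 0 j * v 0 k * T i j k =
    \sum_i \sum_j \sum_k u 0 i * v 0 j * w 0 k * T k i j.
  rewrite exchange_big /=; apply: eq_bigr => j _; rewrite exchange_big /=.
  by apply: eq_bigr => k _; apply: eq_bigr => i _; ring.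
rewrite -/T E2 E3 -!big_split big1 // => i _; rewrite -!big_split big1 // => j _.
rewrite -!big_split big1 // => k _ /=.
by rewrite -[RHS](mulr0 (u 0 i * v 0 j * w 0 k)) -(T0 i j k) /T; ring.
Qed.

(** In the contraction of [al] with [L_(P b) P], the derivatives of [b] come with
    a factor [P al = 0]; the derivatives of [P] that remain are two of the three
    terms of the Jacobi identity, the third one being a derivative along
    [P al]. *)
Lemma lie_bivector_hamiltonian (al : 'rV[R]_n) b : poisson_tensor P ->
  derivable_mx p (fcomp c b) -> al *m P p = 0 ->
  al *m lie_bivector (sharp P b) P p = 0.
Proof.
move=> pP db alP.
have Pal : P p *m al^T = 0 := antisym_mulmx0 (antiP p) alP.
have jT v : v *m jac p (sharp P b) =
    derive_at p v (fcomp c b) *m P p + b p *m derive_at p v (bcomp c P).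
  rewrite -derive_at_vcomp.
  rewrite (@near_eq_derive_at _ _ _ p _ _ _ _ (fun q => fcomp c b q *m bcomp c P q)).
    by rewrite derive_atM // bcomp_chart_at fcomp_chart_at.
  by apply: near_dom => q dq; rewrite vcomp_sharp.
have key v : bilin (lie_bivector (sharp P b) P p) al v = 0.
  rewrite -[RHS](jacobi_trilinear (b p) al v pP) alP.
  have -> : bilin (derive_at p 0 (bcomp c P)) v (b p) = 0.
    rewrite (_ : derive_at p 0 _ = 0) ?/bilin ?mulmx0 ?mul0mx ?mxE //.
    by apply/matrixP => i j; rewrite [LHS]mxE [RHS]mxE pairing0r.
  rewrite addr0 lie_bivectorE /bilin mulmxBr mulmxBr.
  rewrite [al *m (P p *m _)]mulmxA alP mul0mx subr0.
  rewrite mulmxBl addmx00 [RHS](congr1 (fun A : 'M[R]_1 => A 0 0) (addrC _ _)).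
  congr (fun_of_matrix (_ + _) 0 0).
  rewrite -[al *m _ *m _]trmx11 !trmx_mul !trmxK antiP !(mulmxN, mulNmx) opprK.
  rewrite !mulmxA jT mulmxDl -(mulmxA _ (P p)) Pal mulmx0 add0r.
  by rewrite /sharp /anchor.
apply/rowP => j; rewrite [RHS]mxE -[RHS](key (e_ j)) /bilin trmx_delta -colE.
by rewrite [RHS]mxE.
Qed.

End antisymmetric.

End identities.

(** * Extension of local one-forms *)

Section extension.
Context {R : realType} {n : nat} {M : smooth_manifold R n}.
Implicit Types (U V Z : set M) (X : vector_field M) (a b : one_form M).

Notation e_ i := (delta_mx 0 i : 'rV[R]_n).

(** The bump need not be constant near [p]: first order operators only see its
    1-jet, which is that of the constant 1 because the centre of the ball is a
    critical point of [gap]. *)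
Lemma bump_function p V : open V -> V p -> V `<=` dom (chart_at p) ->
  exists rho : M -> R, exists Z : set M,
    [/\ closed Z, Z `<=` V, forall q, ~ Z q -> rho q = 0,
        smooth_function V rho & rho p = 1 /\ diff rho p = 0].
Proof.
move=> oV Vp Vd; set c := chart_at p.
have ac : atlas c by exact: chart_at_atlas.
set x0 := fwd c p; pose B := fwd c @` V.
have oB : open B by exact: image_open.
have Bx0 : B x0 by exists p.
have : nbhs x0 B by exact: open_nbhs_nbhs.
move=> /nbhs_normP[/= r1 r10 Br].
(* the closed ball has to stay inside [B], which contains the open ball [r1] *)
pose r := r1 / 2; have r0 : 0 < r by rewrite divr_gt0.
have KB : [set x | 0 <= gap x0 r x] `<=` B.
  move=> x /= /(gap_norm (ltW r0)) xr; apply: Br; rewrite /= distrC.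
  apply: le_lt_trans xr _; rewrite /r ltr_pdivrMr // ltr_pMr //.
  by rewrite ltr1n.
pose Z := bwd c @` [set x | 0 <= gap x0 r x].
have BK : B `<=` fwd c @` dom c by exact: image_subset.
have cZ : closed Z.
  apply: compact_closed; first exact: points_hausdorff.
  apply: continuous_compact; last exact: gap_compact (ltW r0).
  apply: continuous_in_subspaceT => x; rewrite inE => Kx.
  by apply: bwd_continuous; apply: BK; apply: KB.
have ZV : Z `<=` V.
  by move=> _ [x /KB [q Vq <-] <-]; rewrite fwdK //; exact: Vd.
have g0 : gap x0 r x0 = r ^+ 2.
  by rewrite /gap big1 ?subr0 // => i _; rewrite subrr expr0n.
pose k := flat 1 (r ^+ 2).
have kE : k != 0.
  rewrite /k /flat exprn_gt0 // hornerE mul1r; exact: lt0r_neq0 (expR_gt0 _).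
pose F x : R := k^-1 * flat 1 (gap x0 r x).
have sF : smooth_rV setT F.
  apply: smoothM; [exact: openT | exact: smooth_cst |].
  by apply: smooth_flat; [exact: openT | exact: smooth_gap].
pose rho q : R := if `[< V q >] then F (fwd c q) else 0.
have rhoE q : V q -> rho q = F (fwd c q) by move=> Vq; rewrite /rho asboolT.
exists rho; exists Z; split => //.
- move=> q ZNq; rewrite /rho; case: ifPn => // /asboolP Vq.
  rewrite /F /flat ltNge ifF ?mulr0 //; apply/negbTE; rewrite negbK.
  rewrite leNgt; apply/negP => gq; apply: ZNq; exists (fwd c q); first exact: ltW.
  by rewrite fwdK //; exact: Vd.
- apply: (@eq_smooth_function _ _ _ _ (F \o fwd c)) => //.
    by move=> q Vq; rewrite rhoE.
  apply: smooth_function_chart => //.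
  by apply: smooth_subset sF.
split; first by rewrite rhoE // /F g0 mulVf.
have -> : diff rho p = \row_j partial j F x0.
  apply/rowP => j; rewrite !mxE; apply: near_eq_derive.
  apply: near_open oB Bx0 _ => _ [q Vq <-] /=.
  by rewrite fwdK ?rhoE //; exact: Vd.
apply/rowP => j; rewrite !mxE /partial.
have dg : derivable (gap x0 r) x0 (e_ j).
  by apply: (@smooth_derivable _ _ setT) => //; [exact: openT | exact: smooth_gap].
have [df E] := is_derive_comp_real dg (is_derive_flat 1 (gap x0 r x0)).
have : partial j (gap x0 r) x0 = 0 by exact: partial_gap_center.
rewrite /partial => E0; move: E; rewrite E0 mul0r => E.
have := deriveZ k^-1 df; rewrite E scaler0 => <-.
by [].
Qed.

(** The product is smooth on [V] and zero off [Z], and the open sets [V] and [~` Z]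
    cover the manifold. *)
Lemma smooth_cutoff V Z rho a : open V -> closed Z -> Z `<=` V ->
  (forall q, ~ Z q -> rho q = 0) -> smooth_function V rho ->
  smooth_one_form V a -> smooth_one_form setT (fun q => rho q *: a q).
Proof.
move=> oV cZ ZV rho0 srho sa c ac i.
have oZ : open (~` Z) by exact: closed_openC.
apply: (@smooth_function_sub _ _ _ ((V `&` dom c) `|` (~` Z `&` dom c))).
  move=> q [_ dq]; have [Zq|ZNq] := pselect (Z q); last by right.
  by left; split => //; exact: ZV.
apply: smooth_functionU.
  have oVc : open (V `&` dom c) := openI_dom _ oV.
  apply: (@eq_smooth_function _ _ _ _
    (fun q => rho q * pairing (a q) (coord_field c i q))) => //.
    by move=> q _; rewrite pairingZl.
  apply: smooth_functionM => //; last exact: sa.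
  by apply: smooth_function_sub srho; exact: subIsetl.
apply: (@eq_smooth_function _ _ _ _ (fun=> 0)); first exact: openI_dom.
  by move=> q [ZNq _]; rewrite rho0 // pairingZl mul0r.
exact: smooth_function_cst.
Qed.

Lemma extend_covector p (b0 : 'rV[R]_n) :
  exists2 b : one_form M, smooth_one_form setT b & b p = b0.
Proof.
set c := chart_at p; have ac : atlas c by exact: chart_at_atlas.
have dp : dom c p by exact: chart_at_dom.
have [rho [Z [cZ ZV rho0 srho [rho1 _]]]] :=
  bump_function (dom_open c) dp (@subset_refl _ _).
exists (fun q => rho q *: (b0 *m coframe c q)).
  apply: smooth_cutoff cZ ZV rho0 srho _; first exact: dom_open.
  apply: (smooth_one_form_chart ac) => //; first exact: dom_open.
  apply: (@eq_smooth_mx _ _ _ _ _ _ (fun=> b0)); first exact: dom_open.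
    by move=> q dq; rewrite fcomp_of_components.
  exact: smooth_mx_cst.
by rewrite rho1 scale1r coframe_chart_at mulmx1.
Qed.

End extension.

(** * The metric contravariant connection on the annihilator of the leaves *)

Section main.
Context {R : realType} {n : nat} {M : smooth_manifold R n}.
Implicit Types (U V : set M) (X Y Z : vector_field M) (a b : one_form M).
Variables (g P : bilinear_field M).
Hypotheses (g_riemannian : riemannian_metric g) (P_poisson : poisson_tensor P).

Notation e_ i := (delta_mx 0 i : 'rV[R]_n).

Let symg q : (g q)^T = g q. Proof. by have [s _ _] := g_riemannian. Qed.
Let posg q (v : 'rV[R]_n) : v != 0 -> 0 < bilin (g q) v v.
Proof. by have [_ s _] := g_riemannian; exact: s. Qed.
Let antiP q : (P q)^T = - P q. Proof. exact: P_poisson.1.1. Qed.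
Let sP : smooth_bivector_field P := P_poisson.1.

Lemma metric_unit q : g q \in unitmx.
Proof.
rewrite -row_free_unit -kermx_eq0; apply/eqP/row_matrixP => i; rewrite row0.
apply/eqP; apply: contraT => /(posg q).
by rewrite /bilin -row_mul mulmx_ker row0 mul0mx mxE ltxx.
Qed.

Lemma cometric_flatl q a (v : 'rV[R]_n) :
  bilin (invmx (g q)) (v *m g q) (a q) = pairing (a q) v.
Proof. by rewrite /bilin mulmxK // metric_unit. Qed.

Lemma cometric_flatr q a (v : 'rV[R]_n) :
  bilin (invmx (g q)) (a q) (v *m g q) = pairing (a q) v.
Proof.
rewrite /bilin /pairing trmx_mul symg mulmxA mulmxKV ?metric_unit //.
by rewrite -[in LHS](trmx11 (_ *m _)) trmx_mul trmxK.
Qed.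

Section at_point.
Variables (p : M) (U : set M).
Hypotheses (oU : open U) (Up : U p).
Local Notation c := (chart_at p).

Let ac : atlas c := @chart_at_atlas _ _ _ p.
Let dp : dom c p := @chart_at_dom _ _ _ p.
Let oV : open (U `&` dom c) := openI_dom _ oU.
Let Vp : (U `&` dom c) p := conj Up dp.

Lemma smooth_vector_field_derivable X :
  smooth_vector_field U X -> derivable_mx p (vcomp c X).
Proof.
move=> /(smooth_vcomp _ oU) sX.
exact: smooth_derivable_mx oV Vp (sX c ac).
Qed.

Lemma smooth_one_form_derivable a :
  smooth_one_form U a -> derivable_mx p (fcomp c a).
Proof.
move=> /(smooth_fcomp _ oU) sa.
exact: smooth_derivable_mx oV Vp (sa c ac).
Qed.

Lemma bcomp_derivable : derivable_mx p (bcomp c P).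
Proof. exact: smooth_derivable_mx (dom_open c) dp (smooth_bcomp sP ac). Qed.

End at_point.

Lemma smooth_vector_field_sub U V X : V `<=` U ->
  smooth_vector_field U X -> smooth_vector_field V X.
Proof.
move=> VU sX c ac i; apply: smooth_function_sub (sX c ac i).
exact: setSI.
Qed.

Lemma smooth_one_form_sub U V a : V `<=` U ->
  smooth_one_form U a -> smooth_one_form V a.
Proof.
move=> VU sX c ac i; apply: smooth_function_sub (sX c ac i).
exact: setSI.
Qed.

Lemma tangent_sharp U a : tangent_to_leaves P U (sharp P a).
Proof. by move=> q _; exists (a q). Qed.

Lemma smooth_sharp_setT U b : smooth_one_form setT b ->
  smooth_vector_field U (sharp P b).
Proof.
move=> sb; apply: (@smooth_vector_field_sub setT U _ (@subsetT _ U)).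
exact: smooth_sharp openT sP sb.
Qed.

(** Every vector tangent to the leaves is a value of a global field [P b], because
    every covector is a value of a global form. *)
Lemma perpendicular_flat U X q : perpendicular g P U X -> U q ->
  X q *m g q *m P q = 0.
Proof.
move=> pX Uq; apply: (kernel_pairing (antiP _)) => b0.
have [b sb bq] := extend_covector q b0.
have := pX _ (@smooth_sharp_setT U b sb) (@tangent_sharp U b) q Uq.
rewrite /sharp /anchor bq /bilin /pairing => H.
by rewrite -[b0 *m _ *m (X q *m g q)^T]trmx11 trmx_mul trmxK.
Qed.

Lemma jacE p X Y : (forall v, derive_at p v (vcomp (chart_at p) X) =
  derive_at p v (vcomp (chart_at p) Y)) -> jac p X = jac p Y.
Proof.
move=> H; apply/row_matrixP => i; rewrite !rowE.
by have := H (e_ i); rewrite !derive_at_vcomp.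
Qed.

(** The connection acts on global forms, and [connection_kernel] asks for a form
    that annihilates the leaves everywhere; cutting off a perpendicular field
    achieves both without changing its 1-jet at [p]. *)
Lemma flat_extension p U X : open U -> U p -> smooth_vector_field U X ->
  perpendicular g P U X ->
  exists Xt : vector_field M,
    [/\ smooth_one_form setT (fun q => Xt q *m g q),
        forall q, Xt q *m g q *m P q = 0, Xt p = X p,
        jac p Xt = jac p X & derivable_mx p (vcomp (chart_at p) Xt)].
Proof.
move=> oU Up sX pX; set c := chart_at p.
have ac : atlas c by exact: chart_at_atlas.
have dp : dom c p by exact: chart_at_dom.
have oV : open (U `&` dom c) := openI_dom _ oU.
have Vp : (U `&` dom c) p by [].
have [rho [Z [cZ ZV rho0 srho [rho1 drho]]]] := bump_function oV Vp (@subIsetr _ _ _).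
have drp : derivable_at p rho := smooth_derivable_at oV Vp srho.
have dX := smooth_vector_field_derivable oU Up sX.
have E : vcomp c (fun q => rho q *: X q) = (fun q => rho q *: vcomp c X q).
  by apply/funext => q; rewrite /vcomp scalemxAl.
exists (fun q => rho q *: X q); split.
- rewrite (_ : (fun q => _) = fun q => rho q *: (X q *m g q)); last first.
    by apply/funext => q; rewrite scalemxAl.
  apply: (smooth_cutoff oV cZ ZV rho0 srho).
  apply: (@smooth_one_form_sub U); first exact: subIsetl.
  exact: smooth_flat_form.
- move=> q; have [Zq|ZNq] := pselect (Z q).
    by rewrite -!scalemxAl (perpendicular_flat pX (ZV _ Zq).1) scaler0.
  by rewrite rho0 // scale0r !mul0mx.
- by rewrite rho1 scale1r.
- apply: jacE => v; rewrite -/c E derive_atZ // drho pairing0l scale0r add0r rho1.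
  by rewrite scale1r.
rewrite E => i j; rewrite (_ : (fun q => _) = fun q => rho q * vcomp c X q i j).
  exact: derivable_atM drp (dX i j).
by apply/funext => q; rewrite mxE.
Qed.

Lemma jac0 (p : M) : jac p (fun=> 0 : 'rV[R]_n) = 0.
Proof.
apply/matrixP => l i; rewrite [LHS]mxE [RHS]mxE.
rewrite (_ : (fun q => _) = fun=> 0); first by rewrite diff_cst_at mxE.
by apply/funext => q; rewrite /vcomp mul0mx mxE.
Qed.

Lemma lie_bracket_jet p X Y Z : X p = Y p -> jac p X = jac p Y ->
  lie_bracket Z X p = lie_bracket Z Y p.
Proof. by move=> v j; rewrite !lie_bracketE v j. Qed.

(** This transfers the derivative of the metric to the extensions provided by
    [flat_extension]. *)
Lemma act_metric_jet p Z X Y X' Y' :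
  derivable_mx p (vcomp (chart_at p) X) -> derivable_mx p (vcomp (chart_at p) Y) ->
  derivable_mx p (vcomp (chart_at p) X') -> derivable_mx p (vcomp (chart_at p) Y') ->
  X p = X' p -> Y p = Y' p -> jac p X = jac p X' -> jac p Y = jac p Y' ->
  act Z (fun q => bilin (g q) (X q) (Y q)) p =
  act Z (fun q => bilin (g q) (X' q) (Y' q)) p.
Proof.
move=> dX dY dX' dY' vX vY jX jY; set c := chart_at p.
have ac : atlas c by exact: chart_at_atlas.
have dp : dom c p by exact: chart_at_dom.
pose G q := frame c q *m g q *m (frame c q)^T.
have dG : derivable_mx p G.
  exact: smooth_derivable_mx (dom_open c) dp (smooth_gcomp g_riemannian ac).
have H (A B : vector_field M) : derivable_mx p (vcomp c A) ->
    derivable_mx p (vcomp c B) -> act Z (fun q => bilin (g q) (A q) (B q)) p =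
    (((Z p *m jac p A) *m G p + A p *m derive_at p (Z p) G) *m (B p)^T
     + A p *m G p *m (Z p *m jac p B)^T) 0 0.
  move=> dA dB.
  rewrite (@act_derive_at _ _ _ _ _ _ (fun q => vcomp c A q *m G q *m (vcomp c B q)^T)).
    rewrite derive_atM; [|exact: derivable_mxM|exact: derivable_mx_tr].
    by rewrite derive_atM // derive_at_tr !derive_at_vcomp !vcomp_chart_at.
  by move=> q dq; rewrite (bilin_vcomp ac).
by rewrite (H _ _ dX dY) (H _ _ dX' dY') vX vY jX jY.
Qed.

Section connection.
Variable D : one_form M -> one_form M -> one_form M.
Hypothesis D_metric : metric_contravariant_connection g P D.
Hypothesis D_F : F_connection P D.

(** Since [D_al = 0] for [al] in the kernel of the anchor, torsion-freeness
    identifies [D_b al] with the Lie derivative of [al] along [P b]. *)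
Lemma connection_kernel p a b :
  smooth_one_form setT a -> smooth_one_form setT b ->
  (forall q, a q *m P q = 0) -> D b a p = lie_one_form (sharp P b) a p.
Proof.
move=> sa sb aP.
have Da0 : D a b p = 0 by apply: (D_F (aP p)) => //.
have := connection_torsion_free D_metric sb sa p.
rewrite Da0 subr0 => ->; rewrite /koszul_bracket.
have sh0 : sharp P a = fun=> 0 by apply/funext => q; exact: aP.
have -> : lie_one_form (sharp P a) b p = 0.
  rewrite lie_one_formE sh0 jac0 trmx0 mulmx0 addr0.
  by apply/matrixP => i j; rewrite [LHS]mxE [RHS]mxE pairing0r.
rewrite subr0 (_ : (fun q => _) = fun=> 0) ?diff_cst_at ?subr0 //.
apply/funext => q; have := pairing_kernel (b q) (antiP q) (aP q).
have -> : bilin (P q) (b q) (a q) = pairing (a q) (b q *m P q) by [].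
by [].
Qed.

(** The derivative of [g(X, Y)] along [P b] is the sum of two terms, and each of
    them equals this derivative because brackets of foliated fields with [P b]
    are tangent to the leaves. *)
Lemma metric_bundle_like : bundle_like g P.
Proof.
move=> U oU X Y sX sY fX fY pX pY; split; first exact: smooth_metric.
move=> p Up; rewrite /anchor; apply: (kernel_pairing (antiP _)) => b0.
have [b sb bp] := extend_covector p b0.
have [Xt [sXt Xt0 Xtp jXt dXt]] := flat_extension oU Up sX pX.
have [Yt [sYt Yt0 Ytp jYt dYt]] := flat_extension oU Up sY pY.
have dX := smooth_vector_field_derivable oU Up sX.
have dY := smooth_vector_field_derivable oU Up sY.
pose T := sharp P b.
have -> : pairing (diff (fun q => bilin (g q) (X q) (Y q)) p) (b0 *m P p) =
    act T (fun q => bilin (g q) (X q) (Y q)) p by rewrite /act /T /sharp bp.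
rewrite (act_metric_jet T dX dY dXt dYt) //.
set al := fun q => Xt q *m g q; set be := fun q => Yt q *m g q.
have E1 : (fun q => bilin (g q) (Xt q) (Yt q)) = (fun q => pairing (be q) (Xt q)).
  apply/funext => q; rewrite /pairing /be trmx_mul symg mulmxA //.
have E2 : (fun q => pairing (be q) (Xt q)) = (fun q => pairing (al q) (Yt q)).
  by apply/funext => q; rewrite -(cometric_flatl q be) -(cometric_flatr q al).
have E3 : (fun q => pairing (be q) (Xt q)) = cometric g al be.
  by apply/funext => q; rewrite /cometric /al (cometric_flatl q be).
have tang Z Zt : smooth_vector_field U Z -> foliated P U Z -> Zt p = Z p ->
    jac p Zt = jac p Z -> exists a0 : 'rV[R]_n, lie_bracket T Zt p = a0 *m P p.
  move=> sZ fZ vZ jZ; rewrite (lie_bracket_jet T vZ jZ).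
  have [a0 Ha] := fZ T (@smooth_sharp_setT U b sb) (@tangent_sharp U b) p Up.
  by exists (- a0); rewrite mulNmx -[a0 *m _]Ha !lie_bracketE opprB.
have daT := smooth_one_form_derivable openT (I : setT p) sXt.
have dbT := smooth_one_form_derivable openT (I : setT p) sYt.
have H1 : act T (fun q => pairing (al q) (Yt q)) p =
    pairing (lie_one_form T al p) (Yt p).
  rewrite (lie_pairing T daT dYt); have [a0 ->] := tang Y Yt sY fY Ytp jYt.
  by rewrite (pairing_kernel a0 (antiP p) (Xt0 p)) addr0.
have H2 : act T (fun q => pairing (be q) (Xt q)) p =
    pairing (lie_one_form T be p) (Xt p).
  rewrite (lie_pairing T dbT dXt); have [a0 ->] := tang X Xt sX fX Xtp jXt.
  by rewrite (pairing_kernel a0 (antiP p) (Yt0 p)) addr0.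
have := connection_metric D_metric sb sXt sYt p.
rewrite -/al -/be -/T -E3 /cometric.
rewrite (cometric_flatr _ (D b al)) (cometric_flatl _ (D b be)).
rewrite (connection_kernel p sXt sb Xt0) (connection_kernel p sYt sb Yt0).
rewrite -H1 -H2 -E2 -E1 => /eqP.
by rewrite -subr_eq0 opprD addNKr oppr_eq0 => /eqP.
Qed.

(** When metric compatibility is used in [lie_bivector_koszul], the pairings of
    [X] with [D_b c] and [D_c b] cancel against the Koszul bracket, and only the
    derivatives of the dual form of [X] remain. *)
Lemma lie_bivector_connection (p : M) X (b : 'I_n -> one_form M) :
  smooth_one_form setT (fun q => X q *m g q) ->
  derivable_mx p (vcomp (chart_at p) X) ->
  (forall i, smooth_one_form setT (b i)) -> (forall i, b i p = e_ i) ->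
  let S : 'M[R]_n := \matrix_i D (b i) (fun q => X q *m g q) p in
  lie_bivector X P p = invmx (g p) *m S^T - S *m invmx (g p).
Proof.
move=> sal dX sb bp S; set al := fun q => X q *m g q.
have dP := @bcomp_derivable p.
have db i := smooth_one_form_derivable openT (I : setT p) (sb i).
have symH : (invmx (g p))^T = invmx (g p) by rewrite trmx_inv symg.
have rowS i : D (b i) al p = row i S by rewrite rowK.
have r1 i : e_ i = row i 1%:M :> 'rV[R]_n by rewrite row1.
have metricE i j : act (sharp P (b i)) (fun q => pairing (b j q) (X q)) p =
    pairing (D (b i) (b j) p) (X p) + (S *m invmx (g p)) i j.
  have -> : (fun q => pairing (b j q) (X q)) = cometric g (b j) al.
    by apply/funext => q; rewrite /cometric /al (cometric_flatr q (b j)).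
  rewrite (connection_metric D_metric (sb i) (sb j) sal) /cometric.
  rewrite (cometric_flatr _ (D (b i) (b j))) bp rowS; congr (_ + _).
  by rewrite (bilin_sym _ _ symH) r1 -bilin_rows trmx1 mulmx1.
apply/matrixP => i j.
have -> : lie_bivector X P p i j = bilin (lie_bivector X P p) (b i p) (b j p).
  by rewrite !bp !r1 -bilin_rows trmx1 mulmx1 mul1mx.
rewrite (lie_bivector_koszul antiP dP dX (db i) (db j)) !metricE.
rewrite -(connection_torsion_free D_metric (sb i) (sb j)).
rewrite pairingBl.
have -> : (invmx (g p) *m S^T - S *m invmx (g p)) i j =
    (S *m invmx (g p)) j i - (S *m invmx (g p)) i j.
  have -> : invmx (g p) *m S^T = (S *m invmx (g p))^T by rewrite trmx_mul symH.
  by rewrite [LHS]mxE [X in _ + X]mxE [X in X + _]mxE.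
set t1 := pairing _ _; set t2 := pairing _ _; set t3 := (_ *m _) i j.
set t4 := (_ *m _) j i.
by move: t1 t2 t3 t4 => t1 t2 t3 t4; ring.
Qed.

(** The rows of [S] are the covectors [D_b al]; by the Jacobi identity they lie in
    the kernel of [P], which is contained in that of [L_X P] as [X] is foliated. *)
Lemma foliated_poisson U X : open U -> smooth_vector_field U X ->
  perpendicular g P U X -> foliated P U X -> poisson_vector_field P U X.
Proof.
move=> oU sX pX fX p Up.
have [Xt [sXt Xt0 Xtp jXt dXt]] := flat_extension oU Up sX pX.
have dP := @bcomp_derivable p.
have antiQ := lie_bivector_antisym antiP dP X.
have H i : exists b : one_form M, smooth_one_form setT b /\ b p = e_ i.
  by have [b sb bp] := extend_covector p (e_ i); exists b.
have [b Hb] := choice H.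
pose S : 'M[R]_n := \matrix_i D (b i) (fun q => Xt q *m g q) p.
have QE : lie_bivector X P p = invmx (g p) *m S^T - S *m invmx (g p).
  rewrite -(lie_bivector_connection sXt dXt (fun i => (Hb i).1) (fun i => (Hb i).2)).
  by rewrite !lie_bivectorE Xtp jXt.
(* [X, P be] and [P (L_X be)] are tangent to the leaves, hence so is their
   difference [(L_X P) be] *)
have kerQ (a0 : 'rV[R]_n) : a0 *m P p = 0 -> a0 *m lie_bivector X P p = 0.
  move=> a0P; apply: (kernel_pairing antiQ) => b0.
  have [be sbe bep] := extend_covector p b0.
  have dbe := smooth_one_form_derivable openT (I : setT p) sbe.
  have [c0 Hc] := fX _ (@smooth_sharp_setT U be sbe) (@tangent_sharp U be) p Up.
  have := lie_sharp X dP dbe; rewrite Hc bep => E.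
  have -> : b0 *m lie_bivector X P p = (c0 - lie_one_form X be p) *m P p.
    by rewrite mulmxBl -[c0 *m P p]/(anchor P p c0) E addrC addKr.
  exact: pairing_kernel.
have SP : S *m P p = 0.
  apply/row_matrixP => i; rewrite row_mul rowK row0.
  rewrite (connection_kernel p sXt (Hb i).1 Xt0).
  have da := smooth_one_form_derivable openT (I : setT p) sXt.
  have db := smooth_one_form_derivable openT (I : setT p) (Hb i).1.
  have := lie_sharp (sharp P (b i)) dP da.
  rewrite (lie_bivector_hamiltonian antiP dP P_poisson db (Xt0 p)) addr0 => <-.
  have -> : sharp P (fun q => Xt q *m g q) = fun=> 0 by apply/funext => q; exact: Xt0.
  by rewrite lie_bracketE jac0 mulmx0 mul0mx subr0.
apply: (antisym_posdef_eq0 (symg p) (@posg p) (metric_unit p) antiQ _ QE).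
by apply/row_matrixP => i; rewrite row_mul row0 kerQ // -row_mul SP row0.
Qed.

End connection.

(** * Poisson fields are foliated *)

Lemma smooth_det V k (A : M -> 'M[R]_k) : open V -> smooth_mx V A ->
  smooth_function V (fun q => \det (A q)).
Proof.
move=> oV sA; apply: smooth_function_sum => // s.
apply: smooth_functionM => //; first exact: smooth_function_cst.
by apply: smooth_function_prod => // i; exact: sA.
Qed.

Lemma smooth_adj V k (A : M -> 'M[R]_k) : open V -> smooth_mx V A ->
  smooth_mx V (fun q => \adj (A q)).
Proof.
move=> oV sA i j.
apply: (@eq_smooth_function _ _ _ _ (fun q =>
  (-1) ^+ (j + i) * \det (row' j (col' i (A q))))) => //.
  by move=> q _; rewrite mxE.
apply: smooth_functionM => //; first exact: smooth_function_cst.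
apply: smooth_det => // i' j'.
apply: (@eq_smooth_function _ _ _ _ (fun q => A q (lift j i') (lift i j'))) => //.
by move=> q _; rewrite !mxE.
Qed.

Lemma smooth_mxsub V k l k' l' (f : 'I_k' -> 'I_k) (h : 'I_l' -> 'I_l)
    (A : M -> 'M[R]_(k, l)) : open V ->
  smooth_mx V A -> smooth_mx V (fun q => mxsub f h (A q)).
Proof.
move=> oV sA i j; apply: (@eq_smooth_function _ _ _ _ (fun q => A q (f i) (h j))) => //.
by move=> q _; rewrite mxE.
Qed.

Lemma smooth_mxZ V k l f (A : M -> 'M[R]_(k, l)) : open V -> smooth_function V f ->
  smooth_mx V A -> smooth_mx V (fun q => f q *: A q).
Proof.
move=> oV sf sA i j.
apply: (@eq_smooth_function _ _ _ _ (fun q => f q * A q i j)); first exact: oV.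
  by move=> q _; rewrite mxE.
exact: smooth_functionM oV sf (sA i j).
Qed.

(** The rank being constant, Cramer's formulas yield a smooth [b]; the factor [d]
    is the square of a minor of [P] that does not vanish at [p], and avoids a
    division by it. *)
Lemma tangent_preimage p U Y : regular P -> open U -> U p ->
  smooth_vector_field U Y -> tangent_to_leaves P U Y ->
  exists (b : one_form M) (d : M -> R),
    [/\ derivable_mx p (fcomp (chart_at p) b), derivable_at p d, d p != 0 &
        forall q, U q -> dom (chart_at p) q -> sharp P b q = d q *: Y q].
Proof.
move=> [r rP] oU Up sY tY; set c := chart_at p.
have ac : atlas c by exact: chart_at_atlas.
have dp : dom c p by exact: chart_at_dom.
have oV : open (U `&` dom c) := openI_dom _ oU.
have Vp : (U `&` dom c) p by [].
have [f [h uPp]] : exists f h : 'I_r -> 'I_n, mxsub f h (P p) \in unitmx.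
  by rewrite -(rP p); exact: full_minor.
pose A := bcomp c P; pose y := vcomp c Y.
have sA : smooth_mx (U `&` dom c) A.
  by apply: smooth_mx_sub (smooth_bcomp sP ac); exact: subIsetr.
have sy : smooth_mx (U `&` dom c) y by move/(smooth_vcomp _ oU): sY; apply.
pose d q := \det (mxsub f h (A q)).
have sM := smooth_mxsub f h oV sA.
have sd : smooth_function (U `&` dom c) d := smooth_det oV sM.
pose F q := d q *: (colsub h (y q) *m \adj (mxsub f h (A q)) *m rowsub f 1%:M).
have sF : smooth_mx (U `&` dom c) F.
  have sB := smooth_mxM oV (smooth_mxsub id h oV sy) (smooth_adj oV sM).
  exact: smooth_mxZ oV sd (smooth_mxM oV sB (@smooth_mx_cst _ _ _ _ _ _ _)).
have dp0 : d p != 0 by rewrite /d /A bcomp_chart_at -unitfE -unitmxE.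
exists (fun q => F q *m coframe c q), (fun q => d q * d q); split.
- apply: (smooth_derivable_mx oV Vp).
  by apply: eq_smooth_mx oV _ sF => q [_ dq]; rewrite fcomp_of_components.
- by apply: derivable_atM; exact: smooth_derivable_at oV Vp sd.
- by rewrite mulf_neq0.
move=> q Uq dq; rewrite /sharp /anchor.
have [a0 Ya0] := tY q Uq.
have yE : y q = fcomp c (fun=> a0) q *m A q.
  by rewrite -(vcomp_sharp ac dq) /y /vcomp Ya0.
have rA : (\rank (A q) <= r)%N by rewrite /A (rank_bcomp ac dq) rP.
have yA : (y q <= A q)%MS by rewrite yE submxMl.
have := cramer_preimage f h rA yA; rewrite -/(d q) -/(F q) expr2 => FA.
have uC : (coframe c q)^T \in unitmx.
  by rewrite unitmx_tr; have [] := mulmx1_unit (coframe_frame ac dq).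
apply: (can_inj (mulmxK uC)); rewrite -[in RHS]scalemxAl -[Y q *m _]/(y q) -FA.
by rewrite /A /bcomp !mulmxA.
Qed.

(** Here [X, P b = d Y] is tangent to the leaves, and differs from [d] times
    [X, Y] by a multiple of [Y]. *)
Lemma poisson_foliated U X : regular P -> open U ->
  poisson_vector_field P U X -> foliated P U X.
Proof.
move=> rP oU PX Y sY tY p Up.
have [b [d [db dd d0 bE]]] := tangent_preimage rP oU Up sY tY.
have [a0 Ya0] := tY p Up; set c := chart_at p.
have dY := smooth_vector_field_derivable oU Up sY.
have := lie_sharp X (@bcomp_derivable p) db.
rewrite (PX p Up) mulmx0 addr0 lie_bracketE -derive_at_vcomp.
have dp : dom c p by exact: chart_at_dom.
rewrite (@near_eq_derive_at _ _ _ p _ _ _ _ (fun q => d q *: vcomp c Y q)); last first.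
  apply: (@filterS _ _ _ (U `&` dom c)).
    by move=> q [Uq dq]; rewrite /vcomp (bE q Uq dq) scalemxAl.
  by apply: open_nbhs_nbhs; split => //; exact: openI_dom.
rewrite (derive_atZ _ dd dY) (bE p Up dp) derive_at_vcomp vcomp_chart_at => E.
have key : d p *: lie_bracket X Y p =
    (lie_one_form X b p - pairing (diff d p) (X p) *: a0) *m P p.
  rewrite mulmxBl -E lie_bracketE scalerBr -scalemxAl -scalemxAl.
  rewrite -[a0 *m P p]/(anchor P p a0) -Ya0.
  by rewrite [_ *: Y p + _]addrC addrAC addrK.
exists ((d p)^-1 *: (lie_one_form X b p - pairing (diff d p) (X p) *: a0)).
by rewrite /anchor -scalemxAl -key scalerA mulVf // scale1r.
Qed.

End main.

(** * Bundle-like metrics and Poisson fields *)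

Theorem theorem1p1 (R : realType) (n : nat) (M : smooth_manifold R n)
    (g P : bilinear_field M) (D : one_form M -> one_form M -> one_form M)
    (g_riemannian : riemannian_metric g)
    (P_poisson : poisson_tensor P)
    (P_regular : regular P)
    (D_metric : metric_contravariant_connection g P D)
    (D_F : F_connection P D) :
  bundle_like g P /\
  forall (U : set M) (X : vector_field M),
    open U -> smooth_vector_field U X -> perpendicular g P U X ->
    (foliated P U X <-> poisson_vector_field P U X).
Proof.
split; first exact: metric_bundle_like D_metric D_F.
move=> U X oU sX pX; split; first exact: foliated_poisson D_metric D_F _ _ oU sX pX.
exact: poisson_foliated.
Qed.
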